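(* Consider the full problem $$(\mathrm{P})\quad\min_{\mathbf{p}\in Y}\mathcal{J}(\mathbf{p})+\chi_C(\mathbf{p})$$ and the interface problem $$(\mathrm{P}_\Gamma)\quad\min_{\mathbf{p}_\Gamma\in Y_\Gamma}\mathcal{J}_\Gamma(\mathbf{p}_\Gamma)+\chi_{C_\Gamma}(\mathbf{p}_\Gamma).$$ If $\mathbf{p}^*\in Y$ is a solution of $(\mathrm{P})$, then $\mathbf{p}_\Gamma^*=\mathbf{p}^*|_{Y_\Gamma}$ is a solution of $(\mathrm{P}_\Gamma)$. Conversely, if $\mathbf{p}_\Gamma^*\in Y_\Gamma$ is a solution of $(\mathrm{P}_\Gamma)$, then $\mathbf{p}^*=\mathcal{H}_I\mathbf{p}_\Gamma^*\oplus\mathbf{p}_\Gamma^*$ is a solution of $(\mathrm{P})$.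
   Context: Discretization. $\Omega=(0,M)\times(0,N)$ is the domain of an $M\times N$ image; $\mathcal{T}$ is the collection of the pixels, the unit squares $T_{ij}=(i-1,i)\times(j-1,j)$, $1\le i\le M$, $1\le j\le N$. $\alpha>0$ and $f\in L^2(\Omega)$ are given. $H(\mathrm{div};\Omega)=\{\mathbf{p}\in(L^2(\Omega))^2:\mathrm{div}\,\mathbf{p}\in L^2(\Omega)\}$, and $H_0(\mathrm{div};\Omega)$ is its subspace of fields with vanishing normal component on $\partial\Omega$. $\mathcal{RT}_0(T)$ is the set of fields on $T$ of the form $(a_1+b_1x_1,\,a_2+b_2x_2)$, and $Y=\{\mathbf{q}\in H_0(\mathrm{div};\Omega):\mathbf{q}|_T\in\mathcal{RT}_0(T)\ \forall T\in\mathcal{T}\}$. The degrees of freedom of $\mathbf{q}\in Y$ are the (constant) values $(\mathbf{q})_i$ of $\mathbf{q}\cdot\mathbf{n}$ on the interior pixel edges $i\in\mathcal{I}$ (edges shared by two pixels), with $\mathbf{n}$ the unit normal in the positive coordinate direction; $\{\boldsymbol{\psi}_i\}_{i\in\mathcal{I}}$ is the corresponding dual basis, so $\mathbf{q}=\sum_i(\mathbf{q})_i\boldsymbol{\psi}_i$. $\mathcal{J}(\mathbf{p})=\frac1{2\alpha}\int_\Omega(\mathrm{div}\,\mathbf{p}+\alpha f)^2dx$ and $C=\{\mathbf{p}\in Y:|(\mathbf{p})_i|\le1\ \forall i\in\mathcal{I}\}$. $\chi_S$ is $0$ on $S$ and $+\infty$ off $S$. Domain decomposition. $\Omega$ is decomposed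 in a checkerboard fashion into a $K\times K$ array of disjoint square subdomains $\{\Omega_s\}_{s=1}^{\mathcal{N}}$, $\mathcal{N}=K\times K$, each a union of pixels (up to edges). $\Gamma=\bigcup_{s<t}\Gamma_{st}$, $\Gamma_{st}=\partial\Omega_s\cap\partial\Omega_t$ for adjacent subdomains. $\mathcal{T}_s$ is the set of pixels in $\Omega_s$, $Y_s=\{\mathbf{q}_s\in H_0(\mathrm{div};\Omega_s):\mathbf{q}_s|_T\in\mathcal{RT}_0(T)\ \forall T\in\mathcal{T}_s\}$, with basis index set $\mathcal{I}_s$ (pixel edges interior to $\Omega_s$); $Y_I=\bigoplus_sY_s$. $\mathcal{I}_\Gamma\subset\mathcal{I}$ is the set of edges on $\Gamma$, and $Y_\Gamma=\mathrm{span}\{\boldsymbol{\psi}_i\}_{i\in\mathcal{I}_\Gamma}$. Extending by zero, $Y=Y_I\oplus Y_\Gamma$; $\mathbf{p}|_{Y_\Gamma}$ denotes the $Y_\Gamma$-component of $\mathbf{p}\in Y$. $C_s=\{\mathbf{p}_s\in Y_s:|(\mathbf{p}_s)_i|\le1\ \forall i\in\mathcal{I}_s\}$, $C_I=\bigoplus_sC_s$, $C_\Gamma=\{\mathbf{p}_\Gamma\in Y_\Gamma:|(\mathbf{p}_\Gamma)_i|\le1\ \forall i\in\mathcal{I}_\Gamma\}$. For $\mathbf{p}_\Gamma\in Y_\Gamma$, $\mathcal{H}_I\mathbf{p}_\Gamma\in C_I$ denotes a (not necessarily unique, arbitrarily chosen) minimizer of $\mathbf{p}_I\mapsto\mathcal{J}(\mathbf{p}_I\oplus\mathbf{p}_\Gamma)+\chi_{C_I}(\mathbf{p}_I)$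 over $Y_I$, and $\mathcal{J}_\Gamma(\mathbf{p}_\Gamma)=\mathcal{J}(\mathcal{H}_I\mathbf{p}_\Gamma\oplus\mathbf{p}_\Gamma)$. *)

(* Defs.v *)
From HB Require Import structures.
From mathcomp Require Import all_boot all_order all_algebra.
From mathcomp Require Import all_classical all_reals all_analysis.

Set Implicit Arguments.
Unset Strict Implicit.
Unset Printing Implicit Defensive.

Import Order.TTheory GRing.Theory Num.Theory.
Import numFieldNormedType.Exports.

Local Open Scope classical_set_scope.
Local Open Scope ring_scope.

Notation leb2 R := (@lebesgue_measure R \x @lebesgue_measure R)%E.

Section FunctionSpaces.
Variable R : realType.
Implicit Types (D : set (R * R)) (g phi : R * R -> R) (p q : R * R -> R * R).

Definition L2 D g : Prop :=
  measurable_fun D g /\ (leb2 R).-integrable D (fun x => (g x ^+ 2)%:E).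

Definition L2field D p : Prop :=
  L2 D (fun x => (p x).1) /\ L2 D (fun x => (p x).2).

Definition d1 phi (x : R * R) : R := derive1 (fun t : R => phi (t, x.2)) x.1.
Definition d2 phi (x : R * R) : R := derive1 (fun t : R => phi (x.1, t)) x.2.

Definition C1 phi : Prop :=
  [/\ forall x, derivable (fun t : R => phi (t, x.2)) x.1 1,
      forall x, derivable (fun t : R => phi (x.1, t)) x.2 1,
      continuous (d1 phi) & continuous (d2 phi)].

Definition C1c D phi : Prop :=
  let supp := closure [set x | phi x != 0] in
  [/\ C1 phi, compact supp & supp `<=` D].

(* By mollification, C^1 test functions give the same distributional
   divergence and the same normal trace as C^oo ones. *)
Definition is_weak_div D p g : Prop :=
  L2 D g /\
  forall phi, C1c D phi ->
    \int[leb2 R]_(x in D) ((p x).1 * d1 phi x + (p x).2 * d2 phi x) =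
    - \int[leb2 R]_(x in D) (g x * phi x).

(* The weak divergence is unique only almost everywhere: this picks one. *)
Definition weak_div D p : R * R -> R := xget (fun=> 0) (is_weak_div D p).

Definition Hdiv D p : Prop := L2field D p /\ exists g, is_weak_div D p g.

(* The pairing of the normal trace of p on the boundary of D with phi, by
   Green's formula, g being the divergence of p. *)
Definition normal_trace D p g phi : R :=
  \int[leb2 R]_(x in D)
    ((p x).1 * d1 phi x + (p x).2 * d2 phi x + g x * phi x).

Definition Hdiv0 D p : Prop :=
  Hdiv D p /\
  exists2 g, is_weak_div D p g & forall phi, C1 phi -> normal_trace D p g phi = 0.

(* Fields are compared up to null sets; the representatives of the elements of
   Y and Y_s are only constrained inside the (open) pixels. *)
Definition RT0 D p : Prop :=
  exists a1 b1 a2 b2 : R,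
    forall x, D x -> p x = (a1 + b1 * x.1, a2 + b2 * x.2).

Definition chi (T : Type) (S : set T) (x : T) : \bar R :=
  if x \in S then 0%E else +oo%E.

Definition is_solution (T : Type) (S : set T) (F : T -> \bar R) (x : T) : Prop :=
  S x /\ forall y, S y -> (F x <= F y)%E.

Definition box (a b c d : R) : set (R * R) :=
  [set x | a < x.1 < b /\ c < x.2 < d].

Definition zero_ext D p : R * R -> R * R :=
  fun x => if x \in D then p x else (0, 0).

Definition vadd p q : R * R -> R * R := fun x => p x + q x.

Definition boundary D : set (R * R) := closure D `\` D^°.

End FunctionSpaces.

Section Discretization.
Variables (R : realType) (M N : nat).
Implicit Types (p : R * R -> R * R).

Definition Omega : set (R * R) := box 0 M%:R 0 N%:R.

(* 0-based: pixel (i, j) is T_{i+1,j+1}. *)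
Definition pixel (T : 'I_M * 'I_N) : set (R * R) :=
  box T.1%:R T.1.+1%:R T.2%:R T.2.+1%:R.

(* The edges shared by two pixels: inl (k, j) is {k+1} x (j, j+1), with normal
   (1, 0), and inr (i, k) is (i, i+1) x {k+1}, with normal (0, 1). *)
Definition edge : finType := (('I_M.-1 * 'I_N) + ('I_M * 'I_N.-1))%type.

Definition edge_set (e : edge) : set (R * R) :=
  match e with
  | inl (k, j) => [set x | x.1 = k.+1%:R /\ j%:R < x.2 < j.+1%:R]
  | inr (i, k) => [set x | i%:R < x.1 < i.+1%:R /\ x.2 = k.+1%:R]
  end.

(* (p)_e : p . n is constant along e for p in Y, so it is read off at the
   midpoint of e; since e is a null set, it is the limit (from both sides) of
   p . n at e, whatever the values of p on e itself. *)
Definition dof p (e : edge) : R :=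
  match e with
  | inl (k, j) => lim ((p (k.+1%:R + t, j%:R + 2^-1)).1 @[t --> (0 : R)^'])
  | inr (i, k) => lim ((p (i%:R + 2^-1, k.+1%:R + t)).2 @[t --> (0 : R)^'])
  end.

Definition Y : set (R * R -> R * R) :=
  [set p | Hdiv0 Omega p /\ forall T, RT0 (pixel T) p].

Definition dual_basis (psi : edge -> R * R -> R * R) : Prop :=
  forall e, Y (psi e) /\ forall e', dof (psi e) e' = (e == e')%:R.

Definition J (alpha : R) (f : R * R -> R) p : \bar R :=
  (((2 * alpha)^-1)%:E *
   \int[leb2 R]_(x in Omega) ((weak_div Omega p x + alpha * f x) ^+ 2)%:E)%E.

Definition C : set (R * R -> R * R) :=
  [set p | Y p /\ forall e, `|dof p e| <= 1].

End Discretization.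

Section DomainDecomposition.
Variables (R : realType) (M N K h : nat).
Implicit Types (s t : 'I_K * 'I_K) (e : edge M N) (p : R * R -> R * R).

(* K x K squares, h being the number of pixels along a side of a square. *)
Definition Omega_ s : set (R * R) :=
  box (s.1 * h)%N%:R (s.1.+1 * h)%N%:R (s.2 * h)%N%:R (s.2.+1 * h)%N%:R.

Definition adjacent s t : bool :=
  ((s.1 == t.1) && ((s.2.+1 == t.2 :> nat) || (t.2.+1 == s.2 :> nat))) ||
  ((s.2 == t.2) && ((s.1.+1 == t.1 :> nat) || (t.1.+1 == s.1 :> nat))).

Definition Gamma : set (R * R) :=
  [set x | exists s t, [/\ adjacent s t, boundary (Omega_ s) x
                         & boundary (Omega_ t) x]].

Definition I_ s : set (edge M N) := [set e | edge_set e `<=` Omega_ s].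

Definition I_Gamma : set (edge M N) := [set e | edge_set e `<=` Gamma].

Definition Y_ s : set (R * R -> R * R) :=
  [set p | Hdiv0 (Omega_ s) p /\
    forall T : 'I_M * 'I_N, pixel T `<=` Omega_ s -> RT0 (pixel T) p].

Definition C_ s : set (R * R -> R * R) :=
  [set p | Y_ s p /\ forall e, I_ s e -> `|dof p e| <= 1].

Definition dsum (S : 'I_K * 'I_K -> set (R * R -> R * R)) :
    set (R * R -> R * R) :=
  [set p | exists2 q : 'I_K * 'I_K -> R * R -> R * R,
     forall s, S s (q s) & p = fun x => \sum_s zero_ext (Omega_ s) (q s) x].

Definition Y_I := dsum Y_.
Definition C_I := dsum C_.

Variable psi : edge M N -> R * R -> R * R.

Definition Y_Gamma : set (R * R -> R * R) :=
  [set p | exists c : edge M N -> R,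
     p = fun x => \sum_(e | e \in I_Gamma)
                    (c e * (psi e x).1, c e * (psi e x).2)].

Definition C_Gamma : set (R * R -> R * R) :=
  [set p | Y_Gamma p /\ forall e, I_Gamma e -> `|dof p e| <= 1].

Definition is_interface_part p pG : Prop :=
  Y_Gamma pG /\
  exists2 pI, Y_I pI &
    {ae leb2 R, forall x, Omega M N x -> p x = vadd pI pG x}.

(* The Y_Gamma-component of p in Y = Y_I (+) Y_Gamma. *)
Definition interface_part p : R * R -> R * R :=
  xget (fun=> (0, 0)) (is_interface_part p).

Variables (alpha : R) (f : R * R -> R).

(* The minimizers need not be unique: H is an arbitrary choice of them. *)
Definition is_local_minimizer (H : (R * R -> R * R) -> (R * R -> R * R)) : Prop :=
  forall pG, Y_Gamma pG ->
    C_I (H pG) /\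
    is_solution Y_I
      (fun pI => J M N alpha f (vadd pI pG) + chi R C_I pI)%E (H pG).

Definition J_Gamma (H : (R * R -> R * R) -> (R * R -> R * R)) pG : \bar R :=
  J M N alpha f (vadd (H pG) pG).

End DomainDecomposition.

(* Main.v *)
Require Import Defs.
From mathcomp Require Import all_boot all_order all_algebra.
From mathcomp Require Import all_classical all_reals all_analysis.
From mathcomp Require Import measurable_realfun ring lra.
Set Implicit Arguments.
Unset Strict Implicit.
Unset Printing Implicit Defensive.

Import Order.TTheory GRing.Theory Num.Theory.
Import numFieldNormedType.Exports.
Local Open Scope classical_set_scope.
Local Open Scope ring_scope.

(** The minimum of J over Y can be taken in two stages, first over the interior
    part for a given interface part, then over the interface part; the interface
    problem is the second stage.  This needs three facts.

    - Every p in Y agrees almost everywhere with a sum pI + pG, pI in Y_I and pG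
      in Y_Gamma, and all such sums are in Y ([interface_part_exists],
      [Y_vadd]).
    - The constraint decouples: pI + pG is in C iff pI is in C_I and pG in
      C_Gamma ([C_vadd]).
    - J does not see null sets ([J_le_ae]); it is nonnegative, and finite on Y,
      so that minimizers of J + chi are constrained minimizers
      ([is_solution_chiP]).

    The first two facts need the structure of Y, whose elements are only L2
    fields with a weak divergence.  They are studied through [has_div0 D p g]:
    Green's formula on D holds for p and its divergence g without any boundary
    term, for all C^1 test functions, those that do not vanish on the boundary
    of D included.  This is H_0(div; D) on a bounded D ([Hdiv0P]), and it is
    visibly stable under sums and under extension by zero to a larger domain.
    Therefore Y_I is included in Y.

    The converse rests on two limits with cut-offs in the test function.

    - [has_div0_jump]: if p is affine on both sides of an edge, then p . n takes
      the same value on both sides.  Cutting off a strip of width 1/n around the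
      edge makes the jump the only surviving term.  Extension by zero turns the
      vanishing normal trace on an outer boundary into the same statement.
    - [has_div0_cut]: if p . n vanishes linearly at a line, then p may be cut
      along that line: the part of p on one side still satisfies Green's formula
      without boundary term.  The gradient of the cut-off is of size n on a
      strip where p . n is of size 1/n.

    By the first limit, each p in Y has a flux through each edge, which is its
    degree of freedom ([has_flux], [Y_flux]).  Removing from p the combination
    of the psi e, e on Gamma, with coefficients dof p e leaves a field r with no
    flux through Gamma nor through the boundary of Omega.  On the pixels r is
    affine, so its normal component vanishes linearly at each line bounding
    subdomains ([vanish_linearly]), and four cuts isolate its restriction to a
    subdomain as an element of Y_s ([Y_restrict]).  Likewise, an element of Y_I
    has no flux through Gamma, because each of its summands is zero on at least
    one side of every edge of Gamma. *)

(** * Measure and integration in the plane *)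

Section PlaneMeasure.
Context {R : realType}.
Implicit Types (D E : set (R * R)) (x : R * R) (a b c d : R).

(** Directions are booleans, so that one argument covers vertical and horizontal
    edges; [crd] applies to the points and to the values of a field. *)
Definition crd (i : bool) x : R := if i then x.1 else x.2.

Lemma continuous_crd i : continuous (crd i).
Proof. by case: i => x; [exact: cvg_fst|exact: cvg_snd]. Qed.

Lemma measurable_crd i : measurable_fun setT (crd i).
Proof. by case: i; [exact: measurable_fst|exact: measurable_snd]. Qed.

Lemma boxE a b c d : box a b c d = `]a, b[%classic `*` `]c, d[%classic.
Proof. by apply/seteqP; split => x; rewrite /box /= !in_itv. Qed.

Lemma measurable_box a b c d : measurable (box a b c d).
Proof. by rewrite boxE; apply: measurableX. Qed.

Lemma open_box a b c d : open (box a b c d).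
Proof.
have -> : box a b c d = fst @^-1` `]a, b[%classic `&` snd @^-1` `]c, d[%classic.
  by rewrite boxE.
by apply: openI; apply: open_comp (interval_open _ _) => // x _;
  [exact: cvg_fst|exact: cvg_snd].
Qed.

(** The measurable structure of the plane is the product one, which contains the
    open sets because an open set is the union of its rational squares. *)
Lemma open_measurable2 (U : set (R * R)) : open U -> measurable U.
Proof.
move=> oU.
pose r (k : nat) : R := k.+1%:R^-1.
pose Q (q1 q2 : rat) (k : nat) :=
  box (ratr q1 - r k) (ratr q1 + r k) (ratr q2 - r k) (ratr q2 + r k).
pose F q1 q2 k := if `[< Q q1 q2 k `<=` U >] then Q q1 q2 k else set0.
have -> : U = \bigcup_q1 \bigcup_q2 \bigcup_k F q1 q2 k.
  apply/seteqP; split => [x Ux|x [q1 _ [q2 _ [k _]]]]; last first.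
    by rewrite /F; case: asboolP => // QU /QU.
  have /nbhs_ballP[e /= e0 eU] : nbhs x U by apply: open_nbhs_nbhs.
  have [k kP] : exists k, r k < e / 2.
    have e20 : 0 < e / 2 by rewrite divr_gt0.
    have := @near_infty_natSinv_lt R (PosNum e20).
    by case=> N _ /(_ N (leqnn N)) /= ?; exists N.
  have r0 : 0 < r k by rewrite invr_gt0.
  have /rat_in_itvoo[q1] : x.1 - r k < x.1 + r k by lra.
  have /rat_in_itvoo[q2] : x.2 - r k < x.2 + r k by lra.
  rewrite !in_itv /= => /andP[? ?] /andP[? ?].
  exists q1 => //; exists q2 => //; exists k => //.
  have QU : Q q1 q2 k `<=` U.
    move=> y [/andP[? ?] /andP[? ?]]; apply: eU.
    by split; rewrite /ball /= ltr_norml; apply/andP; split; lra.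
  by rewrite /F asboolT // /Q /box /=; split; apply/andP; split; lra.
apply: bigcupT_measurable_rat => q1; apply: bigcupT_measurable_rat => q2.
apply: bigcupT_measurable => k; rewrite /F; case: ifP => // _.
exact: measurable_box.
Qed.

Lemma continuous_measurable2 (D : set (R * R)) (f : R * R -> R) :
  continuous f -> measurable_fun D f.
Proof.
move=> cf; apply: (@measurable_funS _ _ _ _ setT) => //.
apply: (measurability _ (RGenOpens.measurableE R)) => _ [_ [a [b ->] <-]].
rewrite setTI; apply: open_measurable2.
by apply: open_comp; [move=> + _; exact: cf|exact: interval_open].
Qed.

Lemma lebesgue2_box a b c d : a < b -> c < d ->
  (leb2 R) (box a b c d) = ((b - a) * (d - c))%:E.
Proof.
move=> ab cd; rewrite boxE.
transitivity (@lebesgue_measure R `]a, b[ * @lebesgue_measure R `]c, d[)%E.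
  exact: product_measure1E.
by rewrite !lebesgue_measure_itv /= !lte_fin ab cd.
Qed.

Lemma lebesgue2_line i a : (leb2 R).-negligible [set x | crd i x = a].
Proof.
have h : measurable [set x | crd i x = a].
  have := measurable_crd i measurableT (@measurable_set1 R a).
  by rewrite setTI.
apply/negligibleP => //.
have -> : [set x | crd i x = a] =
    if i then [set a] `*` setT else setT `*` [set a].
  by case: i {h}; apply/seteqP; split => x //=; [case|case].
have prod (A B : set (measurableTypeR R)) : measurable A -> measurable B ->
    (leb2 R) (A `*` B) = (lebesgue_measure A * lebesgue_measure B)%E.
  exact: product_measure1E.
case: i {h}; (apply: eq_trans; first exact: prod).
  by rewrite lebesgue_measure_set1 mul0e.
by rewrite lebesgue_measure_set1 mule0.
Qed.

Lemma ae2S (P Q : R * R -> Prop) : (forall x, P x -> Q x) ->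
  {ae leb2 R, forall x, P x} -> {ae leb2 R, forall x, Q x}.
Proof. by move=> PQ; apply: negligibleS => x /= nQ /PQ. Qed.

(** Null sets have no interior. *)
Lemma ae_exists (Q : R * R -> Prop) D a b c d :
  {ae leb2 R, forall x, D x -> Q x} -> a < b -> c < d ->
  box a b c d `<=` D -> exists2 x, box a b c d x & Q x.
Proof.
move=> aeQ ab cd sub; apply: contrapT => nex.
have neg : (leb2 R).-negligible (box a b c d).
  apply: negligibleS aeQ => x bx /= h.
  by apply: nex; exists x => //; apply: h; apply: sub.
move/negligibleP : neg => /(_ (measurable_box _ _ _ _)).
rewrite [X in X = _](lebesgue2_box ab cd) => -[] /eqP.
by rewrite mulf_eq0 !subr_eq0 !gt_eqF.
Qed.

End PlaneMeasure.

Section Rintegral_facts.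
Context d (T : measurableType d) (R : realType) (mu : {measure set T -> \bar R}).
Implicit Types (D : set T) (f g : T -> R).

Lemma dominated_Rintegral D (f_ : nat -> T -> R) f g :
  measurable D -> (forall n, measurable_fun D (f_ n)) -> measurable_fun D f ->
  mu.-integrable D (EFin \o g) ->
  {ae mu, forall x, D x -> f_ ^~ x @ \oo --> f x} ->
  {ae mu, forall x, D x -> forall n, `|f_ n x| <= g x} ->
  (\int[mu]_(x in D) f_ n x) @[n --> \oo] --> \int[mu]_(x in D) f x.
Proof.
move=> mD mf_ mf ig cvf bnd.
have [] := @dominated_convergence _ _ _ mu D mD (fun n => EFin \o f_ n)
  (EFin \o f) (EFin \o g).
- by move=> n; exact/measurable_EFinP.
- exact/measurable_EFinP.
- by apply: filterS cvf => x h Dx; apply: cvg_EFin; [exact: nearW|exact: h].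
- exact: ig.
- by apply: filterS bnd => x h n Dx; rewrite /= lee_fin; exact: h.
move=> intf _ cv; apply: fine_cvg; rewrite fineK //.
exact: integrable_fin_num.
Qed.

Lemma ae_eq_Rintegral D f g : measurable D ->
  measurable_fun D f -> measurable_fun D g ->
  {ae mu, forall x, D x -> f x = g x} ->
  \int[mu]_(x in D) f x = \int[mu]_(x in D) g x.
Proof.
move=> mD mf mg fg; congr fine; apply: ae_eq_integral => //.
- exact/measurable_EFinP.
- exact/measurable_EFinP.
- by apply: filterS fg => x h Dx; congr EFin; exact: h.
Qed.

Lemma integrable_dom D f g : measurable D -> measurable_fun D f ->
  mu.-integrable D (EFin \o g) -> (forall x, D x -> `|f x| <= g x) ->
  mu.-integrable D (EFin \o f).
Proof.
move=> mD mf ig fg; apply: (@le_integrable _ _ _ _ _ mD _ _ _ _ ig).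
  exact/measurable_EFinP.
move=> x Dx /=; rewrite lee_fin; apply: le_trans (fg x Dx) (ler_norm _).
Qed.
End Rintegral_facts.

Section Fubini.
Context {R : realType}.
Notation mu := (@lebesgue_measure R).

Lemma integrable_tensor (u v : R -> R) :
  mu.-integrable setT (EFin \o u) -> mu.-integrable setT (EFin \o v) ->
  (leb2 R).-integrable setT (fun x => (u x.1 * v x.2)%:E).
Proof.
move=> iu iv.
have mu_ : measurable_fun setT u by apply/measurable_EFinP; exact: measurable_int iu.
have mv_ : measurable_fun setT v by apply/measurable_EFinP; exact: measurable_int iv.
apply/integrable12ltyP.
  by apply/measurable_EFinP; apply: measurable_funM; apply: measurableT_comp.
move/integrableP : (iu) => [_ fu]; move/integrableP : (iv) => [_ fv].
have -> : (\int[mu]_x \int[mu]_y `|(u x * v y)%:E| =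
   \int[mu]_x `|(EFin \o u) x| * \int[mu]_x `|(EFin \o v) x|)%E.
  rewrite -ge0_integralZr //; last 2 first.
  - by apply: measurableT_comp => //; exact/measurable_EFinP.
  - exact: integral_ge0.
  apply: eq_integral => x _; rewrite -ge0_integralZl //.
  - by apply: eq_integral => y _; rewrite /= -EFinM normrM.
  - by apply: measurableT_comp => //; exact/measurable_EFinP.
apply: lte_mul_pinfty => //; first exact: integral_ge0.
by rewrite ge0_fin_numE //; exact: integral_ge0.
Qed.

Lemma Rintegral_tensor (u v : R -> R) :
  mu.-integrable setT (EFin \o u) -> mu.-integrable setT (EFin \o v) ->
  \int[leb2 R]_x (u x.1 * v x.2) = (\int[mu]_x u x) * (\int[mu]_x v x).
Proof.
move=> iu iv; rewrite {1}/Rintegral.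
have := integrable_tensor iu iv => iuv.
rewrite -integral12_prod_meas1 // /fubini_F /=.
under eq_integral.
  move=> x _; under eq_integral do rewrite EFinM.
  rewrite integralZl // -[X in (_ * X)%E]fineK; last exact: integrable_fin_num.
  over.
rewrite integralZr //= fineM //; exact: integrable_fin_num.
Qed.
End Fubini.

(** * One-variable cut-offs of class C^1 *)

Section Profiles.
Context {R : realType}.
Implicit Types (s t h l : R).

(** A Taylor bound of order two gives the derivative; for [pos2] it is a
    polynomial inequality by cases, and no limit has to be taken at the kink. *)
Lemma is_derive_quadratic (f : R -> R) (C x l : R) :
  (forall h, `|f (x + h) - f x - l * h| <= C * h ^+ 2) -> is_derive x 1 f l.
Proof.
move=> fE.
have cv : (fun h => h^-1 *: ((f \o shift x) (h *: 1) - f x)) @ 0^' --> l.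
  apply/cvgrPdist_le => e e0.
  have C0 : 0 <= C by have := le_trans (normr_ge0 _) (fE 1); rewrite expr1n mulr1.
  near=> h.
  have h0 : h != 0 by near: h; exact: nbhs_dnbhs_neq.
  rewrite /= [_%:A]mulr1 (addrC h) -normrN opprB.
  have -> : h^-1 *: (f (x + h) - f x) - l = h^-1 * (f (x + h) - f x - l * h).
    by rewrite /GRing.scale /=; field.
  rewrite normrM normfV mulrC ler_pdivrMr ?normr_gt0 //.
  apply: le_trans (fE h) _; rewrite -normr_id.
  have -> : h ^+ 2 = `|h| * `|h| by rewrite -expr2 real_normK ?num_real.
  rewrite mulrA normr_id ler_wpM2r //.
  have : `|h| <= e / (C + 1).
    near: h; apply: dnbhs0_le; rewrite divr_gt0 //; lra.
  rewrite ler_pdivlMr; last lra.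
  by move=> ?; have := normr_ge0 h; nra.
split; last exact/cvg_lim.
by apply/cvg_ex; exists l.
Unshelve. all: by end_near. Qed.

(** All the cut-offs are compositions of [pos2] with polynomials: it vanishes on
    the negative half-line and is C^1. *)
Definition pos2 s : R := Num.max 0 s ^+ 2.
Definition dpos2 s : R := 2 * Num.max 0 s.

Lemma is_derive_pos2 s : is_derive s 1 pos2 (dpos2 s).
Proof.
apply: (@is_derive_quadratic _ 1) => h; rewrite mul1r /pos2 /dpos2.
rewrite ler_norml; apply/andP.
by have [?|?] := leP 0 (s + h); have [?|?] := leP 0 s; rewrite /Num.max;
  repeat case: ifPn; rewrite -?leNgt => *; split; nra.
Qed.

Lemma continuous_dpos2 : continuous dpos2.
Proof.
move=> s; apply: cvgM; first exact: cvg_cst.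
apply: continuous_max; [exact: cvg_cst|exact: cvg_id].
Qed.

Lemma pos2_ge0 s : 0 <= pos2 s. Proof. exact: sqr_ge0. Qed.

Lemma pos2_le0 s : s <= 0 -> pos2 s = 0.
Proof. by move=> s0; rewrite /pos2 max_l // expr0n. Qed.

Lemma dpos2_le0 s : s <= 0 -> dpos2 s = 0.
Proof. by move=> s0; rewrite /dpos2 max_l // mulr0. Qed.

Lemma pos2E s : 0 <= s -> pos2 s = s ^+ 2.
Proof. by move=> s0; rewrite /pos2 max_r. Qed.

Lemma dpos2E s : 0 <= s -> dpos2 s = 2 * s.
Proof. by move=> s0; rewrite /dpos2 max_r. Qed.

(** [step] rises from 0 to 1 on the unit interval, [hump] is supported in
    [[-1, 1]] with value 1 at 0, and [bell j] is supported in [[j, j + 1]]. *)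
Definition step t : R := pos2 (1 - pos2 (1 - t)).
Definition dstep t : R := dpos2 (1 - pos2 (1 - t)) * dpos2 (1 - t).

Definition hump t : R := pos2 (1 - t ^+ 2).
Definition dhump t : R := dpos2 (1 - t ^+ 2) * (- (2 * t)).

Definition bell (j : R) t : R := pos2 ((t - j) * (j + 1 - t)).
Definition dbell (j : R) t : R :=
  dpos2 ((t - j) * (j + 1 - t)) * (2 * j + 1 - 2 * t).

Lemma is_derive_comp_pos2 (g : R -> R) (dg t : R) :
  is_derive t 1 g dg -> is_derive t 1 (pos2 \o g) (dpos2 (g t) * dg).
Proof.
move=> dgt; have d2 := is_derive_pos2 (g t).
by apply: is_derive1_comp.
Qed.

Lemma is_derive_step t : is_derive t 1 step (dstep t).
Proof.
have d1 : is_derive t 1 (fun t => 1 - t) (-1).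
  by apply: is_derive_eq; rewrite /GRing.scale /=; ring.
have d2 := is_derive_comp_pos2 d1.
have d3 : is_derive t 1 (fun t => 1 - pos2 (1 - t)) (dpos2 (1 - t)).
  by apply: is_derive_eq; rewrite /GRing.scale /=; ring.
exact: (is_derive_comp_pos2 d3).
Qed.

Lemma is_derive_hump t : is_derive t 1 hump (dhump t).
Proof.
apply: is_derive_comp_pos2; apply: is_derive_eq.
by rewrite /GRing.scale /=; ring.
Qed.

Lemma is_derive_bell j t : is_derive t 1 (bell j) (dbell j t).
Proof.
apply: is_derive_comp_pos2; apply: is_derive_eq.
by rewrite /GRing.scale /=; ring.
Qed.

Lemma continuous_is_derive (f : R -> R) (df : R -> R) :
  (forall t, is_derive t 1 f (df t)) -> continuous f.
Proof.
by move=> fE t; apply/differentiable_continuous/derivable1_diffP; case: (fE t).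
Qed.

Lemma continuous_dstep : continuous dstep.
Proof.
move=> t; apply: cvgM.
  apply: (@continuous_comp _ _ _ (fun t => 1 - pos2 (1 - t)) dpos2);
    last exact: continuous_dpos2.
  apply: cvgB; first exact: cvg_cst.
  apply: (@continuous_comp _ _ _ (fun t => 1 - t) pos2);
    last exact: (continuous_is_derive is_derive_pos2).
  by apply: cvgB; [exact: cvg_cst|exact: cvg_id].
apply: (@continuous_comp _ _ _ (fun t => 1 - t) dpos2);
  last exact: continuous_dpos2.
by apply: cvgB; [exact: cvg_cst|exact: cvg_id].
Qed.

Lemma continuous_dhump : continuous dhump.
Proof.
move=> t; apply: cvgM.
  apply: (@continuous_comp _ _ _ (fun t => 1 - t ^+ 2) dpos2);
    last exact: continuous_dpos2.
  by apply: cvgB; [exact: cvg_cst|exact: exprn_continuous].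
by apply: cvgN; apply: cvgM; [exact: cvg_cst|exact: cvg_id].
Qed.

Lemma continuous_dbell j : continuous (dbell j).
Proof.
move=> t; apply: cvgM.
  apply: (@continuous_comp _ _ _ (fun t => (t - j) * (j + 1 - t)) dpos2);
    last exact: continuous_dpos2.
  by apply: cvgM; apply: cvgB; (exact: cvg_cst || exact: cvg_id).
apply: cvgB; first exact: cvg_cst.
by apply: cvgM; [exact: cvg_cst|exact: cvg_id].
Qed.

Lemma step_le0 t : t <= 0 -> step t = 0.
Proof. by move=> t0; apply: pos2_le0; rewrite pos2E; nra. Qed.

Lemma step_ge1 t : 1 <= t -> step t = 1.
Proof. by move=> t1; rewrite /step (@pos2_le0 (1 - t)) ?subr0 ?pos2E ?expr1n ?subr_le0. Qed.

Lemma step_bound t : `|step t| <= 1.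
Proof.
rewrite ger0_norm ?pos2_ge0 //; have := pos2_ge0 (1 - t); rewrite /step.
set a := pos2 (1 - t) => a0; have [?|?] := leP 0 (1 - a).
  rewrite pos2E //; nra.
by rewrite pos2_le0 //; apply: ltW.
Qed.

Lemma dstep_le0 t : t <= 0 -> dstep t = 0.
Proof. by move=> t0; rewrite /dstep dpos2_le0 ?mul0r // pos2E; nra. Qed.

Lemma dstep_ge1 t : 1 <= t -> dstep t = 0.
Proof. by move=> t1; rewrite /dstep (@dpos2_le0 (1 - t)) ?mulr0 ?subr_le0. Qed.

(** With t = n l this bounds l times the derivative of step (n l) uniformly in n,
    which is what balances a normal component of size l near the line l = 0. *)
Lemma dstep_bound t : `|t * dstep t| <= 4.
Proof.
have [t0|t0] := leP t 0; first by rewrite dstep_le0 // mulr0 normr0.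
have [t1|t1] := leP 1 t; first by rewrite dstep_ge1 // mulr0 normr0.
rewrite /dstep (@dpos2E (1 - t)); last lra.
have : 0 <= 1 - pos2 (1 - t) <= 1 by rewrite pos2E; [apply/andP; split; nra|lra].
set a := 1 - pos2 _ => /andP[a0 a1]; rewrite dpos2E //.
have -> : t * (2 * a * (2 * (1 - t))) = 4 * (a * (t * (1 - t))) by ring.
have t2 : 0 <= t * (1 - t) <= 1 by apply/andP; split; nra.
rewrite ger0_norm; nra.
Qed.

Lemma hump0 : hump 0 = 1.
Proof. by rewrite /hump expr0n subr0 pos2E // expr1n. Qed.

Lemma hump_ge1 t : 1 <= `|t| -> hump t = 0.
Proof.
move=> t1; apply: pos2_le0; rewrite -real_normK ?num_real //; nra.
Qed.

Lemma hump_bound t : `|hump t| <= 1.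
Proof.
rewrite ger0_norm ?pos2_ge0 // /hump; have t0 := sqr_ge0 t.
have [?|?] := leP 0 (1 - t ^+ 2); last by rewrite pos2_le0 //; apply: ltW.
rewrite pos2E //; nra.
Qed.

Lemma dhump_ge1 t : 1 <= `|t| -> dhump t = 0.
Proof.
move=> t1; rewrite /dhump dpos2_le0 ?mul0r //.
rewrite -real_normK ?num_real //; nra.
Qed.

Lemma dhump_bound t : `|t * dhump t| <= 4.
Proof.
have [t1|/ltW t1] := leP 1 `|t|; first by rewrite dhump_ge1 // mulr0 normr0.
have t0 := sqr_ge0 t.
have t2 : t ^+ 2 <= 1 by rewrite -real_normK ?num_real // exprn_ile1.
rewrite /dhump dpos2E; last lra.
have -> : t * (2 * (1 - t ^+ 2) * - (2 * t)) = - (4 * (t ^+ 2 * (1 - t ^+ 2))) by ring.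
rewrite normrN ger0_norm; nra.
Qed.

Lemma bell_out j t : ~~ (j < t < j + 1) -> bell j t = 0.
Proof.
by rewrite negb_and -!leNgt => /orP[?|?]; apply: pos2_le0; nra.
Qed.

Lemma dbell_out j t : ~~ (j < t < j + 1) -> dbell j t = 0.
Proof.
by rewrite negb_and -!leNgt => /orP[?|?]; rewrite /dbell dpos2_le0 ?mul0r //; nra.
Qed.

Lemma bell_bound j t : `|bell j t| <= 1.
Proof.
have [/andP[? ?]|h] := boolP (j < t < j + 1); last by rewrite bell_out ?normr0.
rewrite ger0_norm ?pos2_ge0 // /bell pos2E; last nra.
by rewrite exprn_ile1 //; nra.
Qed.

Lemma dbell_bound j t : `|dbell j t| <= 2.
Proof.
have [/andP[? ?]|h] := boolP (j < t < j + 1); last by rewrite dbell_out ?normr0.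
rewrite /dbell dpos2E; last nra.
have h : 0 <= (t - j) * (j + 1 - t) <= 1 by apply/andP; split; nra.
rewrite ler_norml; apply/andP; split; nra.
Qed.

End Profiles.

(** * Functions of two variables of class C^1 *)

Section C1.
Context {R : realType}.
Implicit Types (f phi : R * R -> R) (g u v : bool -> R * R -> R) (x y : R * R).

Definition upd (i : bool) x (t : R) : R * R := if i then (t, x.2) else (x.1, t).

Definition dd (i : bool) phi : R * R -> R := if i then d1 phi else d2 phi.

(** [C1] with its partial derivatives named, which makes products and
    compositions computable. *)
Definition C1_grad phi g : Prop :=
  (forall i x, is_derive (crd i x) 1 (fun t => phi (upd i x t)) (g i x)) /\
  (forall i, continuous (g i)).

Lemma upd_crd i x : upd i x (crd i x) = x.
Proof. by case: i; case: x. Qed.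

Lemma crd_upd i j x t : crd j (upd i x t) = if j == i then t else crd j x.
Proof. by case: i; case: j. Qed.

Lemma C1_grad_dd phi : C1 phi -> C1_grad phi (dd^~ phi).
Proof.
move=> [p1 p2 c1 c2]; split=> [[] x|[]] //=.
  by apply: DeriveDef; [exact: p1|rewrite /d1 derive1E].
by apply: DeriveDef; [exact: p2|rewrite /d2 derive1E].
Qed.

Lemma C1_gradE phi g i : C1_grad phi g -> dd i phi = g i.
Proof.
move=> [dphi _]; apply/funext => x; rewrite /dd.
by case: i; rewrite /d1 /d2 derive1E; [have := dphi true x|have := dphi false x]; case.
Qed.

Lemma C1_gradP phi g : C1_grad phi g -> C1 phi.
Proof.
move=> pg; move: (pg) => [dphi cg]; split.
- by move=> x; case: (dphi true x).
- by move=> x; case: (dphi false x).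
- by have /= -> := C1_gradE true pg.
- by have /= -> := C1_gradE false pg.
Qed.

Lemma derive_bound_lipschitz (h dh : R -> R) (a b C : R) :
  (forall t : R, is_derive t 1 h (dh t)) ->
  (forall t, Num.min a b <= t <= Num.max a b -> `|dh t| <= C) ->
  `|h b - h a| <= C * `|b - a|.
Proof.
move=> hdh; wlog ab : a b / a <= b.
  move=> H bnd; have [ab|/ltW ba] := leP a b; first exact: H.
  by rewrite distrC (distrC b); apply: H => // t; rewrite minC maxC; apply: bnd.
rewrite min_l // max_r // => bnd.
have [|t tab ->] := @MVT_segment R h dh a b ab (fun t _ => hdh t).
  apply: continuous_subspaceT => t.
  by apply/differentiable_continuous/derivable1_diffP; case: (hdh t).
by rewrite normrM ler_wpM2r // bnd // -(itvP tab) /= ?(itvP tab).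
Qed.

(** [C1] only asks for continuous partial derivatives.  Along the second
    coordinate phi is differentiable at x; along the first one the mean value
    theorem applies, the partial derivative being bounded near x. *)
Lemma C1_continuous phi : C1 phi -> continuous phi.
Proof.
move=> /C1_grad_dd [dphi cd] x.
apply/cvgrPdist_lt => e e0.
set C := `|dd true phi x| + 1.
have C0 : 0 < C by rewrite /C ltr_wpDl.
have : \forall y \near x, `|dd true phi x - dd true phi y| < 1.
  by have /cvgrPdist_lt := cd true x; apply.
case/nbhs_ballP => d /= d0 dP.
have : \forall t \near x.2, `|phi x - phi (x.1, t)| < e / 2.
  have : {for x.2, continuous (fun t => phi (upd false x t))}.
    by apply/differentiable_continuous/derivable1_diffP; case: (dphi false x).
  move/cvgrPdist_lt => /(_ (e / 2)); rewrite /= -surjective_pairing; apply.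
  by rewrite divr_gt0.
case/nbhs_ballP => d' /= d'0 d'P.
have m0 : 0 < Num.min (Num.min d d') (e / (2 * C)).
  by rewrite !lt_min d0 d'0 divr_gt0 // mulr_gt0.
apply: filterS (nbhsx_ballx x _ m0) => y [].
rewrite /ball /= !lt_min => /andP[/andP[y1d _] y1e] /andP[/andP[y2d y2d'] _].
have h1 : `|phi x - phi (x.1, y.2)| < e / 2 by apply: d'P.
have h2 : `|phi y - phi (x.1, y.2)| <= C * `|y.1 - x.1|.
  have := @derive_bound_lipschitz (fun t => phi (t, y.2))
    (fun t => dd true phi (t, y.2)) x.1 y.1 C.
  rewrite /= -surjective_pairing; apply.
    by move=> t; have := dphi true (t, y.2).
  move=> t tb.
  have : `|dd true phi x - dd true phi (t, y.2)| < 1.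
    apply: dP; split; rewrite /ball //=.
    move: y1d tb; rewrite !ltr_norml => /andP[? ?] /andP[].
    by rewrite ge_min le_max => /orP[?|?] /orP[?|?]; apply/andP; split; lra.
  rewrite /C distrC => ?.
  have := ler_normD (dd true phi (t, y.2) - dd true phi x) (dd true phi x).
  rewrite subrK; lra.
have h3 : C * `|y.1 - x.1| < e / 2.
  rewrite distrC mulrC -ltr_pdivlMr //.
  by move: y1e; rewrite invfM mulrA.
have -> : phi x - phi y = (phi x - phi (x.1, y.2)) - (phi y - phi (x.1, y.2)) by ring.
apply: le_lt_trans (ler_normB _ _) _; lra.
Qed.

Lemma C1_gradM f phi u v : C1_grad f u -> C1_grad phi v ->
  C1_grad (fun x => f x * phi x) (fun i x => f x * v i x + phi x * u i x).
Proof.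
move=> fu phv; have cf := C1_continuous (C1_gradP fu).
have cp := C1_continuous (C1_gradP phv).
move: fu phv => [df cu] [dp cv]; split => [i x|i x].
  have := is_deriveM (df i x) (dp i x); rewrite /GRing.scale /= upd_crd.
  by apply.
by apply: cvgD; apply: cvgM; (exact: cf||exact: cp||exact: cv||exact: cu).
Qed.

Lemma C1_grad_crd i (h dh : R -> R) : (forall t : R, is_derive t 1 h (dh t)) ->
  continuous dh ->
  C1_grad (h \o crd i) (fun j x => if j == i then dh (crd i x) else 0).
Proof.
move=> hdh cdh; split => [j x|j].
  rewrite /=; have [->|ji] := eqVneq j i.
    rewrite (_ : (fun t => _) = h); first exact: hdh.
    by apply/funext => t; rewrite crd_upd eqxx.
  rewrite (_ : (fun t => _) = cst (h (crd i x))); first exact: is_derive_cst.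
  by apply/funext => t; rewrite crd_upd eq_sym (negbTE ji).
have [_|_] := eqVneq j i => x; last exact: cvg_cst.
by apply: (@continuous_comp _ _ _ (crd i) dh); [exact: continuous_crd|exact: cdh].
Qed.

End C1.

(** * Integrable and square integrable functions on bounded domains *)

Section SquareIntegrable.
Context {R : realType}.
Implicit Types (D E : set (R * R)) (f g phi : R * R -> R) (p q : R * R -> R * R).

Definition bounded_domain D : Prop :=
  measurable D /\ exists a b c d, D `<=` box a b c d.

Lemma bounded_domain_box a b c d : bounded_domain (box a b c d : set (R * R)).
Proof. by split; [exact: measurable_box|exists a, b, c, d]. Qed.

Lemma bounded_domainI D E : bounded_domain D -> measurable E ->
  bounded_domain (D `&` E).
Proof.
move=> [mD [a [b [c [d h]]]]] mE; split; first exact: measurableI.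
by exists a, b, c, d; apply: subset_trans h.
Qed.

Lemma bounded_domain_lty D : bounded_domain D -> ((leb2 R) D < +oo)%E.
Proof.
move=> [mD [a [b [c [d h]]]]].
pose a' := Num.min a (b - 1); pose c' := Num.min c (d - 1).
have ha : a' < b by rewrite /a' gt_min; apply/orP; right; lra.
have hc : c' < d by rewrite /c' gt_min; apply/orP; right; lra.
apply: (@le_lt_trans _ _ ((leb2 R) (box a' b c' d))).
  apply: le_measure; rewrite ?inE //; first exact: measurable_box.
  apply: subset_trans h _ => x [/andP[? ?] /andP[? ?]].
  by split; rewrite /a' /c' gt_min; apply/andP; split => //; apply/orP; left.
by rewrite [X in (X < _)%E](lebesgue2_box ha hc) ltry.
Qed.

Definition L1 D f : Prop := (leb2 R).-integrable D (fun x => (f x)%:E).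

Lemma L1_measurable D f : L1 D f -> measurable_fun D f.
Proof. by move=> h; apply/measurable_EFinP; exact: measurable_int h. Qed.

Lemma L1_le D f g : measurable D -> measurable_fun D f -> L1 D g ->
  (forall x, D x -> `|f x| <= g x) -> L1 D f.
Proof. exact: (@integrable_dom _ _ _ (leb2 R)). Qed.

Lemma L1D D f g : measurable D -> L1 D f -> L1 D g ->
  L1 D (fun x => f x + g x).
Proof.
move=> mD fi gi; have := @integrableD _ _ _ (leb2 R) D mD _ _ fi gi.
by apply: (@eq_integrable _ _ _ (leb2 R) D mD) => x _; rewrite /= EFinD.
Qed.

Lemma L1Z D c f : measurable D -> L1 D f -> L1 D (fun x => c * f x).
Proof.
move=> mD fi; have := @integrableZl _ _ _ (leb2 R) D mD c _ fi.
by apply: (@eq_integrable _ _ _ (leb2 R) D mD) => x _; rewrite /= EFinM.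
Qed.

Lemma L1_norm D f : L1 D f -> L1 D (fun x => `|f x|).
Proof. by move=> h; exact: (integrable_norm h). Qed.

Lemma L10 D : L1 D (fun=> 0).
Proof. exact: integrable0. Qed.

Lemma eq_L1 D f g : measurable D -> (forall x, D x -> f x = g x) ->
  L1 D f -> L1 D g.
Proof.
move=> mD fg; apply: (@eq_integrable _ _ _ (leb2 R) D mD) => x /set_mem Dx.
by rewrite fg.
Qed.

Lemma L1_restrict D E f : measurable D -> measurable E -> E `<=` D ->
  L1 E f -> L1 D (f \_ E).
Proof.
move=> mD mE ED fi; rewrite /L1.
rewrite (_ : (fun _ => _) = (fun x => (f x)%:E) \_ E); last first.
  by apply/funext => x; rewrite /patch; case: ifP.
by apply/(@integrable_restrict _ _ _ (leb2 R)) => //; have -> : D `&` E = E by apply/setIidPr.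
Qed.

Lemma L1_cst D (k : R) : bounded_domain D ->
  L1 D (fun=> k).
Proof.
move=> bD; apply: measurable_bounded_integrable.
- by case: bD.
- exact: bounded_domain_lty.
- exact: measurable_cst.
- exists `|k|; split; first exact: num_real.
  by move=> M kM x _ /=; apply: ltW.
Qed.

Lemma continuous_bounded D phi : bounded_domain D -> continuous phi ->
  exists2 C, 0 <= C & forall x, D x -> `|phi x| <= C.
Proof.
move=> [mD [a [b [c [d h]]]]] cphi.
have cK := compact_setX (@segment_compact R a b) (@segment_compact R c d).
have cphiK : compact (phi @` (`[a, b]%classic `*` `[c, d]%classic)).
  by apply: continuous_compact cK; exact: continuous_subspaceT.
have [C [_ CP]] := compact_bounded cphiK.
exists (`|C| + 1); first by rewrite addr_ge0.
move=> x /h [/andP[? ?] /andP[? ?]].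
apply: (CP (`|C| + 1)); first by rewrite (le_lt_trans (ler_norm _)) // ltrDl.
by exists x => //; split; rewrite /= in_itv /=; apply/andP; split; apply: ltW.
Qed.

Lemma L2_L1 D f : bounded_domain D -> L2 D f -> L1 D f.
Proof.
move=> bD [mf if2]; have mD := bD.1.
apply: (@L1_le _ _ (fun x => 1 + f x ^+ 2)) => //.
  by apply: L1D => //; exact: L1_cst.
move=> x _; have := sqr_ge0 (f x); have := sqr_ge0 (`|f x| - 1).
rewrite -[f x ^+ 2]real_normK ?num_real //; nra.
Qed.

Lemma L1M D f phi : bounded_domain D -> L1 D f -> continuous phi ->
  L1 D (fun x => f x * phi x).
Proof.
move=> bD fi cphi; have mD := bD.1.
have [C C0 CP] := continuous_bounded bD cphi.
apply: (@L1_le _ _ (fun x => C * `|f x|)) => //.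
- apply: measurable_funM; first exact: L1_measurable.
  exact: continuous_measurable2.
- by apply: L1Z => //; exact: L1_norm.
- by move=> x Dx; rewrite normrM mulrC ler_wpM2r // CP.
Qed.

Lemma L2D D f g : measurable D -> L2 D f -> L2 D g -> L2 D (fun x => f x + g x).
Proof.
move=> mD [mf fi] [mg gi]; have mfg := measurable_funD mf mg; split => //.
apply: (@L1_le _ _ (fun x => 2 * f x ^+ 2 + 2 * g x ^+ 2)) => //.
- exact: measurable_funX.
- by apply: L1D => //; exact: L1Z.
move=> x Dx; rewrite ger0_norm ?sqr_ge0 //; have := sqr_ge0 (f x - g x).
nra.
Qed.

Lemma L2Z D c f : measurable D -> L2 D f -> L2 D (fun x => c * f x).
Proof.
move=> mD [mf fi]; have mcf : measurable_fun D (fun x => c * f x).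
  by apply: measurable_funM => //; exact: measurable_cst.
split => //; apply: (@L1_le _ _ (fun x => c ^+ 2 * f x ^+ 2)) => //.
- exact: measurable_funX.
- exact: L1Z.
by move=> x Dx; rewrite exprMn ger0_norm // mulr_ge0 ?sqr_ge0.
Qed.

Lemma L20 D : measurable D -> L2 D (fun=> 0).
Proof.
move=> mD; split; first exact: measurable_cst.
by rewrite expr0n; exact: L10.
Qed.

Lemma L2S D E f : measurable D -> measurable E -> E `<=` D -> L2 D f -> L2 E f.
Proof.
move=> mD mE ED [mf fi]; split; first exact: measurable_funS mf.
exact: integrableS fi.
Qed.

Lemma eq_L2 D f g : measurable D -> (forall x, D x -> f x = g x) -> L2 D f -> L2 D g.
Proof.
move=> mD fg [mf fi]; split.
  by apply: eq_measurable_fun mf => x /set_mem; exact: fg.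
by apply: (eq_L1 mD _ fi) => x Dx; rewrite fg.
Qed.

Lemma L2_restrict D E f : measurable D -> measurable E -> E `<=` D ->
  L2 E f -> L2 D (f \_ E).
Proof.
move=> mD mE ED [mf fi]; have DE : D `&` E = E by apply/setIidPr.
split.
  by apply/(measurable_restrict f mE mD); rewrite DE.
have := L1_restrict mD mE ED fi; apply: eq_L1 => // x _.
by rewrite /patch; case: ifP => //; rewrite expr0n.
Qed.

End SquareIntegrable.

(** * Green's formula without boundary term *)

Section Hdiv0.
Context {R : realType}.
Implicit Types (D E : set (R * R)) (f g k phi : R * R -> R) (p q : R * R -> R * R).

Lemma RintegralD2 D f g : measurable D -> L1 D f -> L1 D g ->
  \int[leb2 R]_(x in D) (f x + g x) =
  \int[leb2 R]_(x in D) f x + \int[leb2 R]_(x in D) g x.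
Proof. by move=> mD; apply: (@RintegralD _ _ _ (leb2 R)). Qed.

Lemma RintegralZ2 D c f : measurable D -> L1 D f ->
  \int[leb2 R]_(x in D) (c * f x) = c * \int[leb2 R]_(x in D) f x.
Proof. by move=> mD; apply: (@RintegralZl _ _ _ (leb2 R)). Qed.

Lemma eq_Rintegral2 D f g : (forall x, D x -> f x = g x) ->
  \int[leb2 R]_(x in D) f x = \int[leb2 R]_(x in D) g x.
Proof. by move=> fg; apply: eq_Rintegral => x /set_mem; exact: fg. Qed.

Lemma Rintegral0 D : \int[leb2 R]_(x in D) (0 : R) = 0.
Proof. by rewrite /Rintegral integral0. Qed.

Definition green p g phi (x : R * R) : R :=
  (p x).1 * d1 phi x + (p x).2 * d2 phi x + g x * phi x.

Lemma greenE i p g phi x : green p g phi x =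
  crd i (p x) * dd i phi x + crd (~~ i) (p x) * dd (~~ i) phi x + g x * phi x.
Proof. by case: i; rewrite /green /= // [X in X + _]addrC. Qed.

(** Membership in H_0(div; D), with the divergence g as a witness. *)
Definition has_div0 D p g : Prop :=
  [/\ L2field D p, L2 D g & forall phi, C1 phi -> normal_trace D p g phi = 0].

Lemma L2_crd D p i : L2field D p -> L2 D (fun x => crd i (p x)).
Proof. by case: i => -[]. Qed.

Lemma L1_flux D p phi : bounded_domain D -> L2field D p -> C1 phi ->
  L1 D (fun x => (p x).1 * d1 phi x + (p x).2 * d2 phi x).
Proof.
move=> bD [p1 p2] [_ _ c1 c2]; apply: L1D; first exact: bD.1.
- by apply: L1M => //; exact: L2_L1.
- by apply: L1M => //; exact: L2_L1.
Qed.

Lemma L1_green D p g phi : bounded_domain D -> L2field D p -> L2 D g ->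
  C1 phi -> L1 D (green p g phi).
Proof.
move=> bD pL2 gL2 cphi; apply: L1D; first exact: bD.1.
  exact: L1_flux.
by apply: L1M; [|exact: L2_L1|exact: C1_continuous].
Qed.

Lemma has_div0_weak_div D p g : bounded_domain D -> has_div0 D p g -> is_weak_div D p g.
Proof.
move=> bD [pL2 gL2 gP]; split => // phi [cphi _ _]; have mD := bD.1.
have := gP _ cphi; rewrite /normal_trace RintegralD2 //.
- by move/eqP; rewrite addr_eq0 => /eqP.
- exact: L1_flux.
- by apply: L1M; [|exact: L2_L1|exact: C1_continuous].
Qed.

(** Green's formula for all C^1 functions contains, for those supported in D, the
    definition of the weak divergence. *)
Lemma Hdiv0P D p : bounded_domain D -> Hdiv0 D p <-> exists g, has_div0 D p g.
Proof.
move=> bD; split=> [[[pL2 _]] [g [gL2 _] gP]|[g pg]]; first by exists g.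
have wd := has_div0_weak_div bD pg; case: pg => pL2 gL2 gP.
split; last by exists g.
by split => //; exists g.
Qed.

Lemma has_div0D D p q g k : bounded_domain D -> has_div0 D p g -> has_div0 D q k ->
  has_div0 D (vadd p q) (fun x => g x + k x).
Proof.
move=> bD [[p1 p2] gL2 gP] [[q1 q2] kL2 kP]; have mD := bD.1; split.
- by split; exact: L2D.
- exact: L2D.
move=> phi cphi; rewrite -[RHS]addr0 -{1}(gP _ cphi) -(kP _ cphi).
rewrite /normal_trace -RintegralD2 //; [|exact: L1_green|exact: L1_green].
by apply: eq_Rintegral2 => x _ /=; ring.
Qed.

Lemma has_div0Z D c p g : bounded_domain D -> has_div0 D p g ->
  has_div0 D (fun x => (c * (p x).1, c * (p x).2)) (fun x => c * g x).
Proof.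
move=> bD [[p1 p2] gL2 gP]; have mD := bD.1; split.
- by split; exact: L2Z.
- exact: L2Z.
move=> phi cphi; rewrite -[RHS](mulr0 c) -(gP _ cphi).
rewrite /normal_trace -RintegralZ2 //; last exact: L1_green.
by apply: eq_Rintegral2 => x _ /=; ring.
Qed.

Lemma has_div00 D : bounded_domain D -> has_div0 D (fun=> 0) (fun=> 0).
Proof.
move=> bD; have mD := bD.1; split; [by split; exact: L20|exact: L20|].
move=> phi cphi; rewrite /normal_trace -[RHS](Rintegral0 D).
by apply: eq_Rintegral2 => x _ /=; ring.
Qed.

Lemma eq_has_div0 D p q g : measurable D -> (forall x, D x -> p x = q x) ->
  has_div0 D p g -> has_div0 D q g.
Proof.
move=> mD pq [[p1 p2] gL2 gP]; split => //.
  by split; [apply: eq_L2 p1|apply: eq_L2 p2] => // x Dx; rewrite pq.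
move=> phi cphi; rewrite -(gP _ cphi).
by apply: eq_Rintegral2 => x Dx; rewrite pq.
Qed.

Lemma has_div0_sum (I : Type) (r : seq I) (P : pred I) (F : I -> R * R -> R * R) D :
  bounded_domain D ->
  (forall i, P i -> exists g, has_div0 D (F i) g) ->
  exists g, has_div0 D (fun x => \sum_(i <- r | P i) F i x) g.
Proof.
move=> bD FP; have mD := bD.1; elim: r => [|i r [g IH]].
  exists (fun=> 0); apply: eq_has_div0 (has_div00 bD) => // x _.
  by rewrite big_nil.
have [Pi|nPi] := boolP (P i); last first.
  exists g; apply: eq_has_div0 IH => // x _.
  by rewrite big_cons (negbTE nPi).
have [k kP] := FP i Pi.
exists (fun x => k x + g x); apply: eq_has_div0 (has_div0D bD kP IH) => // x _.
by rewrite big_cons Pi.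
Qed.

(** Green's formula on D is tested with functions on the whole plane, whose values
    outside D are irrelevant: extension by zero costs nothing. *)
Lemma has_div0_zero_ext D E p g : bounded_domain D -> measurable E -> E `<=` D ->
  has_div0 E p g -> has_div0 D (zero_ext E p) (g \_ E).
Proof.
move=> bD mE ED [[p1 p2] gL2 gP]; have mD := bD.1; split.
- split.
    apply: eq_L2 (L2_restrict mD mE ED p1) => // x _.
    by rewrite /zero_ext /patch; case: ifP.
  apply: eq_L2 (L2_restrict mD mE ED p2) => // x _.
  by rewrite /zero_ext /patch; case: ifP.
- exact: L2_restrict.
move=> phi cphi; rewrite -(gP _ cphi) /normal_trace.
have := @Rintegral_mkcondr _ _ _ (leb2 R) D E (green p g phi).
rewrite (setIidr ED) => ->; apply: eq_Rintegral2 => x _.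
rewrite /zero_ext /patch /green; case: ifP => _ //=.
by rewrite !mul0r !addr0.
Qed.

Lemma cvg_eventually_cst (u : nat -> R) (l : R) (N : nat) :
  (forall n, (N <= n)%N -> u n = l) -> u @ \oo --> l.
Proof. by move=> uN; apply: cvg_near_cst; exists N. Qed.

Lemma exists_large (a : R) : 0 < a ->
  exists N, forall n, (N <= n)%N -> 1 <= n.+1%:R * a.
Proof.
move=> a0; exists (Num.truncn a^-1) => n Nn.
rewrite -ler_pdivrMr // div1r; apply/ltW.
by apply: lt_le_trans (truncnS_gt _) _; rewrite ler_nat.
Qed.

Lemma L1_abs_flux D p i : bounded_domain D -> L2field D p ->
  L1 D (fun x => `|crd i (p x)|).
Proof. by move=> bD /(L2_crd i) pL2; apply: L1_norm; exact: L2_L1. Qed.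

Lemma measurable_halfplane i (s m : R) :
  measurable [set x | 0 < s * (crd i x - m)].
Proof.
have cl : continuous (fun x : R * R => s * (crd i x - m)).
  move=> x; apply: cvgM; first exact: cvg_cst.
  by apply: cvgB; [exact: continuous_crd|exact: cvg_cst].
apply: open_measurable2.
rewrite (_ : [set x | _] = (fun x => s * (crd i x - m)) @^-1` `]0, +oo[%classic).
  by apply: open_comp => [x _|]; [exact: cl|exact: interval_open].
by apply/seteqP; split => x; rewrite /= in_itv /= andbT.
Qed.

(** Testing with phi times step (n l), where l = s (x_i - m), leaves two terms.
    The first tends to Green's formula on the half domain l > 0.  The second is
    phi times the normal component of p times the derivative of the cut-off; it
    is bounded by 4 |B| |phi| and tends to zero pointwise. *)
Lemma has_div0_cut D p g (i : bool) (s m B : R) : bounded_domain D -> `|s| = 1 ->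
  has_div0 D p g ->
  {ae leb2 R, forall x, D x -> 0 < s * (crd i x - m) ->
    `|crd i (p x)| <= B * `|crd i x - m|} ->
  has_div0 (D `&` [set x | 0 < s * (crd i x - m)]) p g.
Proof.
move=> bD s1 [[p1 p2] gL2 gP] aeB; have mD := bD.1.
set P := [set x | _].
have mP : measurable P by exact: measurable_halfplane.
have mDP : measurable (D `&` P) by exact: measurableI.
split; [split|..]; try exact: (@L2S _ D).
move=> phi cphi.
pose h n t : R := step (n.+1%:R * (s * (t - m))).
pose dh n t : R := n.+1%:R * s * dstep (n.+1%:R * (s * (t - m))).
have hdh n (t : R) : is_derive t 1 (h n) (dh n t).
  have d1 : is_derive t 1 (fun t => n.+1%:R * (s * (t - m))) (n.+1%:R * s).
    by apply: is_derive_eq; rewrite /GRing.scale /=; ring.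
  have d2 := is_derive_step (n.+1%:R * (s * (t - m))).
  by rewrite /dh mulrC; exact: is_derive1_comp.
have cdh n : continuous (dh n).
  move=> t; apply: cvgM; first exact: cvg_cst.
  apply: (@continuous_comp _ _ _ (fun t => n.+1%:R * (s * (t - m))) dstep);
    last exact: continuous_dstep.
  apply: cvgM; first exact: cvg_cst.
  apply: cvgM; first exact: cvg_cst.
  by apply: cvgB; [exact: cvg_id|exact: cvg_cst].
pose phin n x := phi x * h n (crd i x).
have gradn n := C1_gradM (C1_grad_dd cphi) (C1_grad_crd i (hdh n) (cdh n)).
have cphin n : C1 (phin n) := C1_gradP (gradn n).
have greenn n x : green p g (phin n) x =
    h n (crd i x) * green p g phi x + phi x * (crd i (p x) * dh n (crd i x)).
  rewrite !(greenE i) !(C1_gradE _ (gradn n)) eqxx.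
  by rewrite /phin /=; case: (i) => /=; ring.
(* At a given point the integrands are eventually constant: for l > 0 the
   cut-off is 1 near the point, for l <= 0 it vanishes with its derivative. *)
have lim1 : \int[leb2 R]_(x in D) green p g (phin n) x @[n --> \oo] -->
    \int[leb2 R]_(x in D) (green p g phi \_ P) x.
  have [C C0 CP] := continuous_bounded bD (C1_continuous cphi).
  have Lg ph : C1 ph -> L1 D (green p g ph) by move=> ?; exact: L1_green.
  apply: (@dominated_Rintegral _ _ _ (leb2 R) D _ _
    (fun x => `|green p g phi x| + C * (4 * `|B|))) => //.
  - by move=> j; apply: L1_measurable; exact: Lg.
  - apply/(measurable_restrict _ mP mD).
    by apply: measurable_funS (L1_measurable (Lg _ cphi)) => // x [].
  - by apply: L1D => //; [apply: L1_norm; exact: Lg|exact: L1_cst].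
  - apply: nearW => x Dx; rewrite /patch; case: ifPn => [/set_mem Px|/negP Px].
      have [N NP] := exists_large Px.
      apply: (@cvg_eventually_cst _ _ N) => n /NP h1.
      by rewrite greenn /h /dh step_ge1 // dstep_ge1 // !mulr0 addr0 mul1r.
    apply: (@cvg_eventually_cst _ _ 0) => n _.
    have h0 : n.+1%:R * (s * (crd i x - m)) <= 0.
      rewrite pmulr_rle0 // leNgt; apply/negP => Px'; apply: Px; exact/mem_set.
    by rewrite greenn /h /dh step_le0 // dstep_le0 // !mulr0 mul0r addr0.
  apply: ae2S aeB => x xB Dx n; rewrite greenn.
  apply: le_trans (ler_normD _ _) _.
  rewrite normrM [X in _ + X]normrM; apply: lerD.
    by apply: ler_piMl => //; exact: step_bound.
  have [h0|h0] := leP (s * (crd i x - m)) 0.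
    rewrite /dh dstep_le0 ?mulr0 ?normr0; first by rewrite mulr0 !mulr_ge0.
    by rewrite pmulr_rle0.
  apply: ler_pM => //; first exact: CP.
  have := dstep_bound (n.+1%:R * (s * (crd i x - m))).
  have := xB Dx h0; rewrite /dh.
  move: (dstep _) => d; rewrite !normrM s1 !mul1r mulr1 => b1 b2.
  have b3 : `|crd i (p x)| <= `|B| * `|crd i x - m|.
    by apply: le_trans b1 _; rewrite ler_wpM2r // ler_norm.
  have : `|crd i (p x)| * (`|n.+1%:R| * `|d|) <=
      `|B| * `|crd i x - m| * (`|n.+1%:R| * `|d|) by rewrite ler_wpM2r // mulr_ge0.
  move/le_trans; apply.
  rewrite -mulrA [4 * _]mulrC ler_wpM2l //; move: b2.
  by rewrite mulrA [_ * `|n.+1%:R|]mulrC.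
have lim0 : \int[leb2 R]_(x in D) green p g (phin n) x @[n --> \oo] --> (0 : R).
  apply: (@cvg_eventually_cst _ _ 0) => n _; exact: gP.
rewrite /normal_trace -[RHS](cvg_unique (@Rhausdorff R) lim1 lim0).
by rewrite -Rintegral_mkcondr.
Qed.

End Hdiv0.

(** * Continuity of the normal component across an edge *)

Section Jump.
Context {R : realType}.
Implicit Types (D E : set (R * R)) (f g k phi : R * R -> R) (p q : R * R -> R * R).
Notation mu := (@lebesgue_measure R).

Lemma Rintegral_derive (F f : R -> R) a b : a < b ->
  (forall t : R, is_derive t 1 F (f t)) -> continuous f ->
  \int[mu]_(t in `[a, b]) f t = F b - F a.
Proof.
move=> ab Ff cf; have cF := continuous_is_derive Ff.
rewrite /Rintegral (@continuous_FTC2 _ _ F _ _ ab) //.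
- exact: continuous_subspaceT.
- split; first by move=> t _; case: (Ff t).
    by apply: cvg_at_right_filter; exact: cF.
  by apply: cvg_at_left_filter; exact: cF.
- by move=> t _; rewrite derive1E; case: (Ff t).
Qed.

Lemma integrable_segment (f : R -> R) a b : continuous f ->
  mu.-integrable setT (EFin \o (f \_ `[a, b])).
Proof.
move=> cf; rewrite -restrict_EFin.
apply/(@integrable_restrict _ _ _ mu) => //; rewrite setTI.
apply: continuous_compact_integrable; first exact: segment_compact.
exact: continuous_subspaceT.
Qed.

Lemma Rintegral_hump (m k : R) a b : a < b ->
  \int[mu]_(t in `[a, b]) (k * dhump (k * (t - m))) =
  hump (k * (b - m)) - hump (k * (a - m)).
Proof.
move=> ab; apply: (@Rintegral_derive (fun t => hump (k * (t - m)))) => //.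
  move=> t; have d1 : is_derive t 1 (fun t => k * (t - m)) k.
    by apply: is_derive_eq; rewrite /GRing.scale /=; ring.
  have d2 := is_derive_hump (k * (t - m)).
  by rewrite mulrC; exact: is_derive1_comp.
move=> t; apply: cvgM; first exact: cvg_cst.
apply: (@continuous_comp _ _ _ (fun t => k * (t - m)) dhump);
  last exact: continuous_dhump.
apply: cvgM; first exact: cvg_cst.
by apply: cvgB; [exact: cvg_id|exact: cvg_cst].
Qed.

Lemma Rintegral_bell (j : R) :
  \int[mu]_(t in `[j, j + 1]) bell j t = 30^-1.
Proof.
pose F (t : R) : R := 3^-1 * (t - j) ^+ 3 - 2^-1 * (t - j) ^+ 4 + 5^-1 * (t - j) ^+ 5.
transitivity (\int[mu]_(t in `[j, j + 1]) ((t - j) ^+ 2 * (j + 1 - t) ^+ 2)).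
  apply: eq_Rintegral => t /set_mem /=; rewrite in_itv /= => /andP[? ?].
  by rewrite /bell pos2E ?exprMn //; nra.
transitivity (F (j + 1) - F j); last first.
  by rewrite /F /=; field.
apply: Rintegral_derive.
- by rewrite ltrDl.
- by move=> t; apply: is_derive_eq; rewrite /GRing.scale /=; field.
move=> t; apply: cvgM.
  apply: (@continuous_comp _ _ _ (fun t => t - j) (fun t => t ^+ 2));
    last exact: exprn_continuous.
  by apply: cvgB; [exact: cvg_id|exact: cvg_cst].
apply: (@continuous_comp _ _ _ (fun t => j + 1 - t) (fun t => t ^+ 2));
  last exact: exprn_continuous.
by apply: cvgB; [exact: cvg_cst|exact: cvg_id].
Qed.

Definition edge_nbhd (i : bool) (m j : R) : set (R * R) :=
  [set x | 0 < `|crd i x - m| < 1 /\ j < crd (~~ i) x < j + 1].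

Definition side (m L Rr t : R) : R := if t < m then L else Rr.

Lemma Rintegral_tensor_crd (i : bool) (u v : R -> R) :
  mu.-integrable setT (EFin \o u) -> mu.-integrable setT (EFin \o v) ->
  \int[leb2 R]_x (u (crd i x) * v (crd (~~ i) x)) =
    (\int[mu]_x u x) * (\int[mu]_x v x).
Proof.
case: i => iu iv; first exact: Rintegral_tensor.
rewrite [RHS]mulrC -Rintegral_tensor //; congr fine.
by apply: eq_integral => x _; rewrite mulrC.
Qed.

(** The function is a product of a function of x_i by one of the other
    coordinate.  The hump, whose derivative appears in the first factor, rises
    from 0 to 1 on the left of m and falls back to 0 on its right, whence L - Rr;
    1/30 is the integral of the bell. *)
Lemma integral_jump (i : bool) (m j L Rr : R) (n : nat) :
  \int[leb2 R]_x (side m L Rr (crd i x) *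
     (n.+1%:R * dhump (n.+1%:R * (crd i x - m))) * bell j (crd (~~ i) x)) =
  (L - Rr) / 30.
Proof.
pose dh t := n.+1%:R * dhump (n.+1%:R * (t - m)).
have cdh : continuous dh.
  move=> t; apply: cvgM; first exact: cvg_cst.
  apply: (@continuous_comp _ _ _ (fun t => n.+1%:R * (t - m)) dhump);
    last exact: continuous_dhump.
  apply: cvgM; first exact: cvg_cst.
  by apply: cvgB; [exact: cvg_id|exact: cvg_cst].
have n1 : 1 <= n.+1%:R :> R by rewrite ler1n.
have dh1 t : 1 <= `|t - m| -> dh t = 0.
  move=> t1; rewrite /dh dhump_ge1 ?mulr0 // normrM ger0_norm //; nra.
have dhm : dh m = 0 by rewrite /dh subrr mulr0 /dhump mulr0 oppr0 mulr0 mulr0.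
have UE t : side m L Rr t * dh t =
    L * (dh \_ `[m - 1, m]) t + Rr * (dh \_ `[m, m + 1]) t.
  rewrite /side /patch !mem_setE !in_itv /=.
  have [tm|tm|->] := ltgtP t m.
  - rewrite /= andbT mulr0 addr0; case: ifPn => // /negP t1.
    by rewrite mulr0 dh1 ?mulr0 //; rewrite ltr0_norm ?subr_lt0 //; lra.
  - rewrite /= andbF mulr0 add0r; case: ifPn => // /negP t1.
    by rewrite mulr0 dh1 ?mulr0 //; rewrite gtr0_norm ?subr_gt0 //; lra.
  - by rewrite dhm !if_same !mulr0 addr0.
have VE t : bell j t = (bell j \_ `[j, j + 1]) t.
  rewrite /patch mem_setE in_itv /=; case: ifPn => // h; apply: bell_out.
  by apply: contra h => /andP[? ?]; apply/andP; split; apply: ltW.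
have iU : mu.-integrable setT (EFin \o (fun t => side m L Rr t * dh t)).
  have i1 := @integrableD _ _ _ mu setT measurableT _ _
    (@integrableZl _ _ _ mu setT measurableT L _ (integrable_segment (m - 1) m cdh))
    (@integrableZl _ _ _ mu setT measurableT Rr _ (integrable_segment m (m + 1) cdh)).
  apply: (@eq_integrable _ _ _ mu setT measurableT _ _ _ i1) => t _.
  by rewrite /= UE EFinD !EFinM.
have iV : mu.-integrable setT (EFin \o bell j).
  rewrite (_ : bell j = bell j \_ `[j, j + 1]); last by apply/funext.
  by apply: integrable_segment; exact: continuous_is_derive (@is_derive_bell R j).
rewrite (@Rintegral_tensor_crd i (fun t => side m L Rr t * dh t) (bell j)) //.
have -> : \int[mu]_x bell j x = 30^-1.
  rewrite -(Rintegral_bell j) [RHS]Rintegral_mkcond.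
  by apply: eq_Rintegral => t _; exact: VE.
congr (_ * _).
have is1 := integrable_segment (m - 1) m cdh.
have is2 := integrable_segment m (m + 1) cdh.
have -> : \int[mu]_x (side m L Rr x * dh x) =
   \int[mu]_x (L * (dh \_ `[m - 1, m]) x + Rr * (dh \_ `[m, m + 1]) x).
  by apply: eq_Rintegral => t _; exact: UE.
rewrite (@RintegralD _ _ _ mu setT _ _ measurableT); last 2 first.
- exact: (@integrableZl _ _ _ mu setT measurableT L _ is1).
- exact: (@integrableZl _ _ _ mu setT measurableT Rr _ is2).
rewrite (@RintegralZl _ _ _ mu setT _ L measurableT is1).
rewrite (@RintegralZl _ _ _ mu setT _ Rr measurableT is2).
rewrite -!Rintegral_mkcond !Rintegral_hump ?ltrDl //; last by rewrite gtrDl ltrN10.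
rewrite subrr mulr0 hump0 addrAC subrr sub0r addrAC subrr add0r.
rewrite !hump_ge1 ?mulrN ?normrN ?mulr1 ?ger0_norm //; ring.
Qed.

(** The test function is hump (n (x_i - m)) times bell j of the other coordinate.
    In Green's formula, the terms without the derivative of the hump tend to
    zero, as the support shrinks to the edge.  So does the contribution of the
    deviation of the normal component from its one-sided values L and Rr, which
    is of size 1/n where the derivative is of size n.  What remains is
    (L - Rr) / 30, for every n. *)
Lemma has_div0_jump D p g (i : bool) (m j L Rr B : R) : bounded_domain D ->
  edge_nbhd i m j `<=` D -> has_div0 D p g ->
  (forall x, edge_nbhd i m j x ->
     `|crd i (p x) - side m L Rr (crd i x)| <= B * `|crd i x - m|) ->
  L = Rr.
Proof.
move=> bD PD [pL2 gL2 gP] pB; have mD := bD.1.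
pose h n t : R := hump (n.+1%:R * (t - m)).
pose dh n t : R := n.+1%:R * dhump (n.+1%:R * (t - m)).
have hdh n (t : R) : is_derive t 1 (h n) (dh n t).
  have d1 : is_derive t 1 (fun t => n.+1%:R * (t - m)) n.+1%:R.
    by apply: is_derive_eq; rewrite /GRing.scale /=; ring.
  have d2 := is_derive_hump (n.+1%:R * (t - m)).
  by rewrite /dh mulrC; exact: is_derive1_comp.
have cdh n : continuous (dh n).
  move=> t; apply: cvgM; first exact: cvg_cst.
  apply: (@continuous_comp _ _ _ (fun t => n.+1%:R * (t - m)) dhump);
    last exact: continuous_dhump.
  apply: cvgM; first exact: cvg_cst.
  by apply: cvgB; [exact: cvg_id|exact: cvg_cst].
have gradn n := C1_gradM (C1_grad_crd i (hdh n) (cdh n))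
  (C1_grad_crd (~~ i) (@is_derive_bell R j) (@continuous_dbell R j)).
pose phin n x := h n (crd i x) * bell j (crd (~~ i) x).
have cphin n : C1 (phin n) := C1_gradP (gradn n).
pose V n x := side m L Rr (crd i x) * dh n (crd i x) * bell j (crd (~~ i) x).
(* V n is the part that survives in the limit. *)
have greenn n x : green p g (phin n) x - V n x =
    (crd i (p x) - side m L Rr (crd i x)) * dh n (crd i x) *
      bell j (crd (~~ i) x) +
    h n (crd i x) * (crd (~~ i) (p x) * dbell j (crd (~~ i) x) +
      g x * bell j (crd (~~ i) x)).
  rewrite !(greenE i) !(C1_gradE _ (gradn n)) !eqxx.
  by rewrite /phin /V /=; case: (i) => /=; ring.
have dh1 n t : 1 <= `|t - m| -> dh n t = 0.
  move=> t1; rewrite /dh dhump_ge1 ?mulr0 // normrM ger0_norm //.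
  have : 1 <= n.+1%:R :> R by rewrite ler1n.
  nra.
have dhm n : dh n m = 0 by rewrite /dh subrr mulr0 /dhump mulr0 oppr0 mulr0 mulr0.
(* The bell cuts off along the edge, the hump across it, and dhump is zero on
   the edge itself. *)
have out n x : ~ edge_nbhd i m j x -> dh n (crd i x) * bell j (crd (~~ i) x) = 0.
  move=> nP; have [xj|/bell_out->] := boolP (j < crd (~~ i) x < j + 1); last by rewrite mulr0.
  have [xm|/dh1->] := ltP `|crd i x - m| 1; last by rewrite mul0r.
  have [->|xm0] := eqVneq (crd i x) m; first by rewrite dhm mul0r.
  by exfalso; apply: nP; split => //; rewrite xm normr_gt0 subr_eq0 xm0.
have bnd n x : D x -> `|green p g (phin n) x - V n x| <=
    4 * `|B| + (2 * `|crd (~~ i) (p x)| + `|g x|).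
  move=> Dx; rewrite greenn.
  have H1 : `|(crd i (p x) - side m L Rr (crd i x)) * dh n (crd i x) *
      bell j (crd (~~ i) x)| <= 4 * `|B|.
    have [Px|/out nPx] := pselect (edge_nbhd i m j x); last first.
      by rewrite -mulrA nPx mulr0 normr0 mulr_ge0.
    rewrite normrM -[4 * _]mulr1; apply: ler_pM => //; last exact: bell_bound.
    have := dhump_bound (n.+1%:R * (crd i x - m)); rewrite /dh.
    move: (dhump _) => d b2; rewrite normrM.
    have b3 : `|crd i (p x) - side m L Rr (crd i x)| <= `|B| * `|crd i x - m|.
      by apply: le_trans (pB x Px) _; rewrite ler_wpM2r // ler_norm.
    have := ler_wpM2r (normr_ge0 (n.+1%:R * d)) b3.
    move/le_trans; apply; rewrite -mulrA [4 * _]mulrC ler_wpM2l //.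
    by rewrite -normrM mulrCA mulrA.
  have H2 : `|h n (crd i x)| <= 1 by exact: hump_bound.
  have H3 : `|crd (~~ i) (p x) * dbell j (crd (~~ i) x) +
      g x * bell j (crd (~~ i) x)| <= 2 * `|crd (~~ i) (p x)| + `|g x|.
    apply: le_trans (ler_normD _ _) _; apply: lerD.
      by rewrite normrM mulrC ler_wpM2r // dbell_bound.
    by rewrite normrM -[leRHS]mulr1 ler_wpM2l // bell_bound.
  apply: le_trans (ler_normD _ _) _; apply: lerD => //.
  rewrite normrM; apply: le_trans H3; exact: ler_piMl.
have Lgreen n : L1 D (green p g (phin n)) by exact: L1_green.
have mV n : measurable_fun setT (V n).
  apply: measurable_funM.
    apply: measurable_funM.
      apply: measurable_fun_ifT; [|exact: measurable_cst|exact: measurable_cst].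
      by apply: measurable_fun_ltr; [exact: measurable_crd|exact: measurable_cst].
    apply: continuous_measurable2.
    by move=> x; apply: (@continuous_comp _ _ _ (crd i) (dh n)); [exact: continuous_crd|exact: cdh].
  apply: continuous_measurable2 => x.
  apply: (@continuous_comp _ _ _ (crd (~~ i)) (bell j)); first exact: continuous_crd.
  exact: (continuous_is_derive (@is_derive_bell R j)).
have LF : L1 D (fun x => 4 * `|B| + (2 * `|crd (~~ i) (p x)| + `|g x|)).
  apply: L1D => //; first exact: L1_cst.
  apply: L1D => //; last by apply: L1_norm; exact: L2_L1.
  by apply: L1Z => //; exact: L1_abs_flux.
have mF n : measurable_fun D (fun x => green p g (phin n) x - V n x).
  apply: measurable_funB; first exact: L1_measurable.
  exact: measurable_funS (mV n).
have LFn n : L1 D (fun x => green p g (phin n) x - V n x).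
  exact: (L1_le mD (mF n) LF (bnd n)).
have intV n : \int[leb2 R]_(x in D) V n x = (L - Rr) / 30.
  rewrite -(integral_jump i m j L Rr n) Rintegral_mkcond.
  apply: eq_Rintegral2 => x _; rewrite /patch /V; case: ifPn => [_|/negP Dx].
    by rewrite /dh.
  rewrite -mulrA [_ * bell _ _]out ?mulr0 //.
  by move=> Px; apply: Dx; apply/mem_set; exact: PD.
have intF n : \int[leb2 R]_(x in D) (green p g (phin n) x - V n x) = - ((L - Rr) / 30).
  have LV : L1 D (V n).
    have := L1D mD (Lgreen n) (L1Z (-1) mD (LFn n)).
    by apply: eq_L1 => // x _; ring.
  rewrite (@RintegralB _ _ _ (leb2 R) _ _ _ mD (Lgreen n) LV) intV.
  by rewrite [X in X - _](gP _ (cphin n)) sub0r.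
have lim1 : \int[leb2 R]_(x in D) (green p g (phin n) x - V n x) @[n --> \oo] -->
    \int[leb2 R]_(x in D) (0 : R).
  apply: (@dominated_Rintegral _ _ _ (leb2 R) D _ _ _ mD mF _ LF).
  - exact: measurable_cst.
  - apply: negligibleS (lebesgue2_line i m) => x /= nx; apply: contrapT => xm.
    apply: nx => Dx; have xm0 : 0 < `|crd i x - m|.
      by rewrite normr_gt0 subr_eq0; apply/eqP.
    have [N NP] := exists_large xm0.
    apply: (@cvg_eventually_cst R _ _ N) => n /NP h1.
    have h1' : 1 <= `|n.+1%:R * (crd i x - m)| by rewrite normrM ger0_norm.
    by rewrite greenn /h /dh hump_ge1 // dhump_ge1 // !mulr0 !mul0r addr0.
  - by apply: aeW => x Dx n; exact: bnd.
have lim2 : \int[leb2 R]_(x in D) (green p g (phin n) x - V n x) @[n --> \oo] -->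
    - ((L - Rr) / 30).
  by apply: (@cvg_eventually_cst R _ _ 0) => n _; exact: intF.
have E : \int[leb2 R]_(x in D) (0 : R) = - ((L - Rr) / 30).
  by apply: (cvg_unique (@Rhausdorff R) lim1 lim2).
move/eqP: E; rewrite Rintegral0 eq_sym oppr_eq0 mulf_eq0 invr_eq0 pnatr_eq0 orbF.
by rewrite subr_eq0 => /eqP.
Qed.

End Jump.

(** * The flux of a field through an edge *)

Section Flux.
Context {R : realType}.
Implicit Types (D E : set (R * R)) (p q : R * R -> R * R) (i : bool) (m j : R).

Definition ibox i (a b c d : R) : set (R * R) :=
  [set x | a < crd i x < b /\ c < crd (~~ i) x < d].

Lemma iboxE i a b c d : ibox i a b c d = if i then box a b c d else box c d a b.
Proof. by case: i; apply/seteqP; split => x [] //= h1 h2; split. Qed.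

(** The normal component is v up to a multiple of the distance to the edge, along
    the whole edge.  A limit at the midpoint follows from it, and for v = 0 it is
    the local form of the hypothesis of [has_div0_cut]. *)
Definition has_flux i m j p (v : R) : Prop :=
  exists B, forall x, edge_nbhd i m j x -> `|crd i (p x) - v| <= B * `|crd i x - m|.

Lemma crdD i (x y : R * R) : crd i (x + y) = crd i x + crd i y.
Proof. by case: i. Qed.

Lemma has_fluxD i m j p q v w :
  has_flux i m j p v -> has_flux i m j q w -> has_flux i m j (vadd p q) (v + w).
Proof.
move=> [B pB] [B' qB]; exists (B + B') => x Px.
rewrite /vadd crdD mulrDl opprD addrACA; apply: le_trans (ler_normD _ _) _.
by apply: lerD; [exact: pB|exact: qB].
Qed.

Lemma has_fluxZ i m j p c v : has_flux i m j p v ->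
  has_flux i m j (fun x => (c * (p x).1, c * (p x).2)) (c * v).
Proof.
move=> [B pB]; exists (`|c| * B) => x Px.
have -> : crd i (c * (p x).1, c * (p x).2) = c * crd i (p x) by case: i {pB Px}.
by rewrite -mulrBr normrM -mulrA ler_wpM2l // pB.
Qed.

Lemma has_flux0 i m j : has_flux i m j (fun=> 0) 0.
Proof. by exists 0 => x _; rewrite mul0r; case: i; rewrite subr0 normr0. Qed.

Lemma has_flux_sum i m j (I : Type) (r : seq I) (P : pred I)
    (F : I -> R * R -> R * R) (v : I -> R) :
  (forall k, P k -> has_flux i m j (F k) (v k)) ->
  has_flux i m j (fun x => \sum_(k <- r | P k) F k x) (\sum_(k <- r | P k) v k).
Proof.
move=> FP; elim: r => [|k r IH].
  rewrite big_nil (_ : (fun _ => _) = fun=> 0); first exact: has_flux0.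
  by apply/funext => x; rewrite big_nil.
rewrite big_cons; case: ifPn => [Pk|/negbTE nPk].
  rewrite (_ : (fun _ => _) = vadd (F k) (fun x => \sum_(k <- r | P k) F k x)).
    by apply: has_fluxD IH; exact: FP.
  by apply/funext => x; rewrite big_cons Pk.
rewrite (_ : (fun _ => _) = (fun x => \sum_(k <- r | P k) F k x)) //.
by apply/funext => x; rewrite big_cons nPk.
Qed.

Lemma eq_has_flux i m j p q v : (forall x, edge_nbhd i m j x -> p x = q x) ->
  has_flux i m j p v -> has_flux i m j q v.
Proof. by move=> pq [B pB]; exists B => x Px; rewrite -pq //; exact: pB. Qed.

Definition half_nbhd (s : bool) i m j : set (R * R) :=
  if s then ibox i m (m + 1) j (j + 1) else ibox i (m - 1) m j (j + 1).

Lemma half_nbhd_sub s i m j : half_nbhd s i m j `<=` edge_nbhd i m j.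
Proof.
case: s => x [/andP[? ?] ?]; split => //.
  by rewrite gtr0_norm ?subr_gt0 //; apply/andP; split; lra.
by rewrite ltr0_norm ?subr_lt0 //; apply/andP; split; lra.
Qed.

Lemma edge_nbhd_half i m j x : edge_nbhd i m j x ->
  (half_nbhd false i m j x /\ crd i x < m) \/ (half_nbhd true i m j x /\ m < crd i x).
Proof.
move=> [/andP[]]; rewrite normr_gt0 subr_eq0 => xm.
have [xlt|xgt|/eqP] := ltgtP (crd i x) m; last by rewrite (negbTE xm).
  rewrite ltr0_norm ?subr_lt0 // => ? ?; left; split => //; split => //.
  by apply/andP; split; lra.
rewrite gtr0_norm ?subr_gt0 // => ? ?; right; split => //; split => //.
by apply/andP; split; lra.
Qed.

(** The bound holds at points of the half neighbourhood arbitrarily close to the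
    edge, since every small box contains a point outside the exceptional set.
    One side is enough, which is used at edges where the field is zero on the
    other side. *)
Lemma flux_rigid (s : bool) i m j (v w C : R) :
  {ae leb2 R, forall x, half_nbhd s i m j x -> `|v - w| <= C * `|crd i x - m|} ->
  v = w.
Proof.
move=> ae; apply/eqP; rewrite -subr_eq0 -normr_eq0 eq_le normr_ge0 andbT.
rewrite leNgt; apply/negP => d0.
(* At distance less than e the bound contradicts v != w; e <= 1 keeps the box
   inside the half neighbourhood. *)
pose e := Num.min 1 (`|v - w| / (`|C| + 1)).
have C1 : 0 < `|C| + 1 by rewrite ltr_wpDl.
have e0 : 0 < e by rewrite /e lt_min ltr01 divr_gt0.
have e1 : e <= 1 by rewrite /e ge_min lexx.
pose a := if s then m else m - e.
have [x xin] : exists2 x, ibox i a (a + e) j (j + 1) x &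
    `|v - w| <= C * `|crd i x - m|.
  have sub : ibox i a (a + e) j (j + 1) `<=` half_nbhd s i m j.
    rewrite /a; case: (s) => x [/andP[? ?] ?]; split => //; apply/andP; split; lra.
  have aae : a < a + e by lra.
  have jj : j < j + 1 by rewrite ltrDl.
  move: sub; rewrite iboxE; case: (i) ae => ae sub; exact: ae_exists ae _ _ sub.
apply/negP; rewrite -ltNge.
have xe : `|crd i x - m| < e.
  move: xin => [+ _]; rewrite /a ltr_norml; case: (s) => /andP[? ?];
    by apply/andP; split; lra.
have xe' : `|crd i x - m| < `|v - w| / (`|C| + 1).
  by apply: lt_le_trans xe _; rewrite /e ge_min lexx orbT.
rewrite ltr_pdivlMr // in xe'; apply: le_lt_trans xe'.
have := ler_norm C; have := normr_ge0 (crd i x - m); nra.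
Qed.

Lemma has_flux_ae_unique i m j p q v w D : edge_nbhd i m j `<=` D ->
  {ae leb2 R, forall x, D x -> p x = q x} ->
  has_flux i m j p v -> has_flux i m j q w -> v = w.
Proof.
move=> PD pq [B pB] [B' qB].
apply: (@flux_rigid true i m j v w (B + B')); apply: ae2S pq => x pqx Hx.
have Px := half_nbhd_sub Hx; have := pB x Px; have := qB x Px.
rewrite pqx; last exact: PD.
rewrite mulrDl => h1 h2.
rewrite (_ : v - w = (crd i (q x) - w) - (crd i (q x) - v)); last by ring.
by apply: le_trans (ler_normB _ _) _; rewrite addrC lerD.
Qed.

Lemma has_flux_zero s i m j p v : (forall x, half_nbhd s i m j x -> p x = 0) ->
  has_flux i m j p v -> v = 0.
Proof.
move=> p0 [B pB]; apply: (@flux_rigid s i m j v 0 B); apply: aeW => x Hx.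
have := pB x (half_nbhd_sub Hx); rewrite p0 //.
by rewrite (_ : crd i 0 = 0) ?sub0r ?normrN ?subr0 //; case: i {pB p0 Hx}.
Qed.

Lemma RT0_crd i m D p : RT0 D p ->
  exists L B, forall x, D x -> crd i (p x) - L = B * (crd i x - m).
Proof.
move=> [a1 [b1 [a2 [b2 pE]]]].
exists (if i then a1 + b1 * m else a2 + b2 * m), (if i then b1 else b2) => x Dx.
by rewrite pE //; case: i => /=; ring.
Qed.

(** Affine on each side gives one-sided values; they agree by [has_div0_jump]. *)
Lemma flux_exists D i m j p g : bounded_domain D -> edge_nbhd i m j `<=` D ->
  has_div0 D p g -> (forall s, RT0 (half_nbhd s i m j) p) ->
  exists v, has_flux i m j p v.
Proof.
move=> bD PD pg rt.
have [L [B LB]] := RT0_crd i m (rt false).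
have [Rr [B' RB]] := RT0_crd i m (rt true).
have bnd x : edge_nbhd i m j x ->
    `|crd i (p x) - side m L Rr (crd i x)| <= (`|B| + `|B'|) * `|crd i x - m|.
  move=> /edge_nbhd_half[[Hx xm]|[Hx xm]]; rewrite /side.
    by rewrite xm LB // normrM mulrDl lerDl mulr_ge0.
  by rewrite ltNge (ltW xm) /= RB // normrM mulrDl lerDr mulr_ge0.
have LR := has_div0_jump bD PD pg bnd.
exists L, (`|B| + `|B'|) => x Px.
by have := bnd x Px; rewrite /side -LR if_same.
Qed.

Lemma RT0D D p q : RT0 D p -> RT0 D q -> RT0 D (vadd p q).
Proof.
move=> [a1 [b1 [a2 [b2 pE]]]] [c1 [d1 [c2 [d2 qE]]]].
exists (a1 + c1), (b1 + d1), (a2 + c2), (b2 + d2) => x Dx.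
rewrite /vadd pE // qE //; congr pair; rewrite /=; ring.
Qed.

Lemma RT0Z D c p : RT0 D p -> RT0 D (fun x => (c * (p x).1, c * (p x).2)).
Proof.
move=> [a1 [b1 [a2 [b2 pE]]]].
exists (c * a1), (c * b1), (c * a2), (c * b2) => x Dx.
rewrite pE //; congr pair; rewrite /=; ring.
Qed.

Lemma RT00 D : RT0 D (fun=> 0 : R * R).
Proof. by exists 0, 0, 0, 0 => x _; rewrite !mul0r addr0. Qed.

Lemma eq_RT0 D p q : (forall x, D x -> p x = q x) -> RT0 D p -> RT0 D q.
Proof.
move=> pq [a1 [b1 [a2 [b2 pE]]]]; exists a1, b1, a2, b2 => x Dx.
by rewrite -pq // pE.
Qed.

Lemma RT0_sum D (I : Type) (r : seq I) (P : pred I) (F : I -> R * R -> R * R) :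
  (forall k, P k -> RT0 D (F k)) -> RT0 D (fun x => \sum_(k <- r | P k) F k x).
Proof.
move=> FP; elim: r => [|k r IH].
  by apply: eq_RT0 (RT00 D) => x _; rewrite big_nil.
have [Pk|nPk] := boolP (P k).
  by apply: eq_RT0 (RT0D (FP _ Pk) IH) => x _; rewrite big_cons Pk.
by apply: eq_RT0 IH => x _; rewrite big_cons (negbTE nPk).
Qed.

Lemma has_flux_cvg i m j p v : has_flux i m j p v ->
  crd i (p (upd i (upd (~~ i) 0 (j + 2^-1)) (m + t))) @[t --> (0:R)^'] --> v.
Proof.
move=> [B pB]; apply/cvgrPdist_le => e e0; near=> t.
have t0 : t != 0 by near: t; exact: nbhs_dnbhs_neq.
have t1 : `|t| < 1 by near: t; exact: dnbhs0_lt.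
have te : `|t| <= e / (`|B| + 1) by near: t; apply: dnbhs0_le; rewrite divr_gt0 // ltr_wpDl.
set z := upd _ _ _.
have cz : crd i z = m + t by rewrite /z crd_upd eqxx.
have cz' : crd (~~ i) z = j + 2^-1.
  by rewrite /z !crd_upd eqxx; case: (i).
have zm : crd i z - m = t by rewrite cz; ring.
have /pB : edge_nbhd i m j z.
  by rewrite /edge_nbhd /= zm normr_gt0 t0 t1 cz'; split => //; apply/andP; split; lra.
rewrite zm distrC.
move/le_trans; apply.
apply: (@le_trans _ _ (`|B| * `|t|)); first by rewrite ler_wpM2r // ler_norm.
move: te; rewrite ler_pdivlMr ?ltr_wpDl // => te.
have := normr_ge0 t; nra.
Unshelve. all: by end_near. Qed.

End Flux.

(** * Pixels, edges and subdomains *)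

Section Grid.
Context {R : realType}.
Variables (K h : nat).
Hypothesis h0 : (0 < h)%N.
Notation n := (K * h)%N.
Implicit Types (i : bool) (T : 'I_n * 'I_n) (e : edge n n) (s t : 'I_K * 'I_K).

Definition cix (k : nat) i (T : 'I_k * 'I_k) : 'I_k := if i then T.1 else T.2.
Definition mkix (k : nat) i (a b : 'I_k) : 'I_k * 'I_k := if i then (a, b) else (b, a).

Lemma cix_mkix k i (a b : 'I_k) : cix i (mkix i a b) = a.
Proof. by case: i. Qed.
Lemma cixN_mkix k i (a b : 'I_k) : cix (~~ i) (mkix i a b) = b.
Proof. by case: i. Qed.
Lemma mkix_cix k i (T : 'I_k * 'I_k) : mkix i (cix i T) (cix (~~ i) T) = T.
Proof. by case: i; case: T. Qed.

Lemma pixelE i T : pixel T =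
  ibox i (cix i T)%:R (cix i T).+1%:R (cix (~~ i) T)%:R (cix (~~ i) T).+1%:R :> set (R * R).
Proof. by rewrite iboxE; case: i. Qed.

Lemma Omega_E i s : Omega_ h s =
  ibox i (cix i s * h)%N%:R ((cix i s).+1 * h)%N%:R
         (cix (~~ i) s * h)%N%:R ((cix (~~ i) s).+1 * h)%N%:R :> set (R * R).
Proof. by rewrite iboxE; case: i. Qed.

Lemma OmegaE i : Omega n n = ibox i 0 n%:R 0 n%:R :> set (R * R).
Proof. by rewrite iboxE; case: i. Qed.

Lemma blk_subproof (k : 'I_n) : (k %/ h < K)%N.
Proof. by rewrite ltn_divLR. Qed.
Definition blk (k : 'I_n) : 'I_K := Ordinal (blk_subproof k).

Local Arguments blk : simpl never.

Definition block T : 'I_K * 'I_K := (blk T.1, blk T.2).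

Lemma cix_block i T : cix i (block T) = blk (cix i T).
Proof. by case: i. Qed.

Lemma blk_lb (k : 'I_n) : (blk k * h <= k)%N.
Proof. exact: leq_divM. Qed.

Lemma blk_ub (k : 'I_n) : (k < (blk k).+1 * h)%N.
Proof. exact: ltn_ceil. Qed.

Lemma blk_unique (k : 'I_n) (a : 'I_K) : (a * h <= k < a.+1 * h)%N -> blk k = a.
Proof.
move=> /andP[h1 h2]; apply/val_inj => /=; apply/eqP.
by rewrite eqn_leq -ltnS ltn_divLR // h2 leq_divRL.
Qed.

Lemma pixel_Omega_ T : pixel T `<=` (Omega_ h (block T) : set (R * R)).
Proof.
move=> x [/andP[a1 a2] /andP[b1 b2]]; split; apply/andP; split.
- by apply: le_lt_trans a1; rewrite ler_nat; exact: blk_lb.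
- by apply: (lt_le_trans a2); rewrite ler_nat; exact: blk_ub.
- by apply: le_lt_trans b1; rewrite ler_nat; exact: blk_lb.
- by apply: (lt_le_trans b2); rewrite ler_nat; exact: blk_ub.
Qed.

Lemma block_overlap (a b : 'I_K) (x : R) :
  (a * h)%N%:R < x < (a.+1 * h)%N%:R -> (b * h)%N%:R < x < (b.+1 * h)%N%:R -> a = b.
Proof.
move=> /andP[a1 a2] /andP[b1 b2]; apply/val_inj/eqP; rewrite eqn_leq.
have := lt_trans a1 b2; have := lt_trans b1 a2.
by rewrite !ltr_nat !ltn_pmul2r // !ltnS => -> ->.
Qed.

Lemma Omega_disjoint s t (x : R * R) : Omega_ h s x -> Omega_ h t x -> s = t.
Proof.
move=> [s1 s2] [t1 t2]; rewrite [s]surjective_pairing [t]surjective_pairing.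
by congr pair; [exact: block_overlap s1 t1|exact: block_overlap s2 t2].
Qed.

Lemma pixel_disjoint s T (x : R * R) : s != block T -> pixel T x -> ~ Omega_ h s x.
Proof.
by move=> /eqP sT /pixel_Omega_ Tx sx; apply: sT; exact: Omega_disjoint sx Tx.
Qed.

Lemma Omega_sub s : Omega_ h s `<=` (Omega n n : set (R * R)).
Proof.
move=> x [/andP[a1 a2] /andP[b1 b2]]; split; apply/andP; split.
- by apply: le_lt_trans a1.
- by apply: (lt_le_trans a2); rewrite ler_nat leq_pmul2r.
- by apply: le_lt_trans b1.
- by apply: (lt_le_trans b2); rewrite ler_nat leq_pmul2r.
Qed.

Lemma pixel_Omega T : pixel T `<=` (Omega n n : set (R * R)).
Proof. by apply: subset_trans (@pixel_Omega_ T) _; exact: Omega_sub. Qed.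

(** The grid lines are negligible. *)
Lemma ae_pixel : {ae leb2 R, forall x, Omega n n x -> exists T : 'I_n * 'I_n, pixel T x}.
Proof.
have neg : (leb2 R).-negligible
    (\bigcup_(k : nat) ([set x | crd true x = k%:R] `|` [set x | crd false x = k%:R])).
  by apply: negligible_bigcup => k; apply: negligibleU; exact: lebesgue2_line.
apply: negligibleS neg => x /= nx; apply: contrapT => ngrid; apply: nx.
move=> [/andP[a1 a2] /andP[b1 b2]].
have cell (i : bool) : 0 < crd i x -> crd i x < n%:R ->
    exists k : 'I_n, k%:R < crd i x < k.+1%:R.
  move=> x0 xn; have := truncn_itv (ltW x0) => /andP[t1 t2].
  have tn : (Num.truncn (crd i x) < n)%N.
    by rewrite -(ltr_nat R); exact: le_lt_trans xn.
  exists (Ordinal tn); rewrite /= t2 andbT lt_neqAle t1 andbT.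
  apply/eqP => E; apply: ngrid; exists (Num.truncn (crd i x)) => //.
  by rewrite E; case: (i); [left|right].
have [k1 k1P] := cell true a1 a2; have [k2 k2P] := cell false b1 b2.
by exists (k1, k2).
Qed.

(** An edge is normal to the direction [edge_dir], lies on the grid line number
    [(edge_line e).+1], and separates the pixels of indices [edge_line e] and
    [(edge_line e).+1] in that direction. *)
Definition edge_dir e : bool := if e is inl _ then true else false.
Definition edge_line e : 'I_n.-1 := match e with inl kj => kj.1 | inr ik => ik.2 end.
Definition edge_row e : 'I_n := match e with inl kj => kj.2 | inr ik => ik.1 end.
Definition mkedge i (k : 'I_n.-1) (j : 'I_n) : edge n n :=
  if i then inl (k, j) else inr (j, k).

Lemma lower_index_subproof (k : 'I_n.-1) : (k < n)%N.
Proof. by apply: leq_trans (ltn_ord k) (leq_pred _). Qed.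
Lemma upper_index_subproof (k : 'I_n.-1) : (k.+1 < n)%N.
Proof. by rewrite -ltn_predRL. Qed.
Definition lower_index e : 'I_n := Ordinal (lower_index_subproof (edge_line e)).
Definition upper_index e : 'I_n := Ordinal (upper_index_subproof (edge_line e)).

Definition edge_pixel (sd : bool) e : 'I_n * 'I_n :=
  mkix (edge_dir e) (if sd then upper_index e else lower_index e) (edge_row e).

Notation enbhd e := (edge_nbhd (edge_dir e) (edge_line e).+1%:R (edge_row e)%:R).
Notation ehalf sd e := (half_nbhd sd (edge_dir e) (edge_line e).+1%:R (edge_row e)%:R).

Lemma ehalfE sd e : ehalf sd e = pixel (edge_pixel sd e) :> set (R * R).
Proof.
rewrite (pixelE (edge_dir e)) /edge_pixel cix_mkix cixN_mkix /half_nbhd.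
by case: sd; rewrite /= -!natr1 ?addrK.
Qed.

Lemma edge_setE e (x : R * R) : edge_set e x <->
  crd (edge_dir e) x = (edge_line e).+1%:R /\
  (edge_row e)%:R < crd (~~ edge_dir e) x < (edge_row e).+1%:R.
Proof. by case: e => -[a b] //=; split => -[]. Qed.

Lemma enbhd_pixel e (x : R * R) : enbhd e x -> exists sd, pixel (edge_pixel sd e) x.
Proof.
by move=> /edge_nbhd_half[[+ _]|[+ _]]; rewrite ehalfE; [exists false|exists true].
Qed.

Lemma enbhd_Omega e : enbhd e `<=` (Omega n n : set (R * R)).
Proof. by move=> x /enbhd_pixel[sd]; exact: pixel_Omega. Qed.

Definition edge_block (sd : bool) e := block (edge_pixel sd e).

Lemma cix_edge_block sd e : cix (edge_dir e) (edge_block sd e) =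
  blk (if sd then upper_index e else lower_index e).
Proof. by rewrite cix_block cix_mkix. Qed.
Lemma cixN_edge_block sd e : cix (~~ edge_dir e) (edge_block sd e) = blk (edge_row e).
Proof. by rewrite cix_block cixN_mkix. Qed.

Lemma edge_block_eq e :
  (edge_block false e == edge_block true e) = (blk (lower_index e) == blk (upper_index e)).
Proof.
apply/eqP/eqP => [E|E].
  by have := congr1 (cix (edge_dir e)) E; rewrite !cix_edge_block.
rewrite -[LHS](mkix_cix (edge_dir e)) -[RHS](mkix_cix (edge_dir e)).
by rewrite !cix_edge_block !cixN_edge_block E.
Qed.

Lemma edge_interior e : edge_block false e = edge_block true e ->
  I_ R h (edge_block false e) e.
Proof.
move=> E x /edge_setE[xk /andP[xj xj']].
have Eb : blk (lower_index e) = blk (upper_index e) by apply/eqP; rewrite -edge_block_eq E.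
rewrite (Omega_E (edge_dir e)) cix_edge_block cixN_edge_block; split; apply/andP; split.
- by rewrite xk ltr_nat ltnS; exact: (blk_lb (lower_index e)).
- by rewrite xk ltr_nat Eb; exact: (blk_ub (upper_index e)).
- by apply: le_lt_trans xj; rewrite ler_nat; exact: blk_lb.
- by apply: (lt_le_trans xj'); rewrite ler_nat; exact: blk_ub.
Qed.

(** A point of the edge, to read off properties of [edge_set e]. *)
Definition edge_mid e : R * R :=
  upd (edge_dir e) (upd (~~ edge_dir e) 0 ((edge_row e)%:R + 2^-1)) (edge_line e).+1%:R.

Lemma edge_mid_edge e : edge_set e (edge_mid e).
Proof.
apply/edge_setE; rewrite /edge_mid !crd_upd eqxx.
have -> : (~~ edge_dir e == edge_dir e) = false by case: (edge_dir e).
rewrite eqxx -natr1; split => //; apply/andP; split; lra.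
Qed.

Lemma edge_of_subdomain s e : I_ R h s e -> forall sd, edge_block sd e = s.
Proof.
move=> sub sd; have Oz := sub _ (edge_mid_edge e).
have /edge_setE[zk /andP[j1 j2]] := edge_mid_edge e.
move: Oz; rewrite (Omega_E (edge_dir e)) => -[]; rewrite zk => /andP[].
rewrite !ltr_nat => k1 k2 /andP[j3 j4].
rewrite -[LHS](mkix_cix (edge_dir e)) -[RHS](mkix_cix (edge_dir e)) cix_edge_block cixN_edge_block.
congr mkix; apply: blk_unique.
  by case: sd; rewrite /= ?(ltnW k1) ?k2 // -ltnS k1 (ltn_trans _ k2).
have := lt_trans j1 j4; rewrite ltr_nat => ->.
by have := lt_trans j3 j2; rewrite ltr_nat ltnS => ->.
Qed.

Lemma closure_ibox i (a b c d : R) (x : R * R) : a < b ->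
  a <= crd i x <= b -> c < crd (~~ i) x < d -> closure (ibox i a b c d) x.
Proof.
move=> ab /andP[ax xb] cx B /nbhs_ballP[e /= e0 eB].
(* Move x a little towards the middle of the interval. *)
pose dl := Num.min 2^-1 (e / (b - a)).
have ba0 : 0 < b - a by rewrite subr_gt0.
have dl0 : 0 < dl by rewrite lt_min invr_gt0 ltr0n divr_gt0.
have dl1 : dl <= 2^-1 by rewrite ge_min lexx.
have dle : dl * (b - a) <= e by rewrite -ler_pdivlMr // ge_min lexx orbT.
pose u := crd i x + dl * ((a + b) / 2 - crd i x).
exists (upd i x u); split.
  rewrite /ibox /= !crd_upd eqxx /u; split; first by apply/andP; split; nra.
  by have -> : (~~ i == i) = false by case: (i).
have ue : `|crd i x - u| < e.
  rewrite /u opprD addrA subrr sub0r normrN normrM gtr0_norm //.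
  apply: lt_le_trans dle; rewrite ltr_pM2l // ltr_norml; apply/andP; split; lra.
have eb0 y : `|y - y| < e :> R by rewrite subrr normr0.
by apply: eB; split; move: ue; rewrite /ball /= /upd; case: (i) => /= ue; (exact: ue || exact: eb0).
Qed.

Lemma adjacent_cix i s t : cix (~~ i) s = cix (~~ i) t ->
  cix i t = (cix i s).+1 :> nat -> Defs.adjacent s t.
Proof. by rewrite /Defs.adjacent; case: i => /= -> ->; rewrite !eqxx /= ?orbT. Qed.

(** If the two pixels are in different blocks, the line of the edge is a multiple
    of h, and it bounds both subdomains. *)
Lemma edge_interface e : edge_block false e != edge_block true e -> I_Gamma R K h e.
Proof.
rewrite edge_block_eq => ne x /edge_setE[xk xj].
have lb := blk_lb (lower_index e); have ub := blk_ub (upper_index e).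
have lb' := blk_lb (upper_index e); have ub' := blk_ub (lower_index e).
have E : blk (upper_index e) = (blk (lower_index e)).+1 :> nat.
  apply/eqP; rewrite eqn_leq; apply/andP; split.
    rewrite -ltnS -(ltn_pmul2r h0); apply: leq_ltn_trans lb' _.
    apply: leq_ltn_trans (_ : _ <= (blk (lower_index e)).+1 * h)%N _ => //.
    by rewrite ltn_pmul2r.
  rewrite ltn_neqAle; apply/andP; split; first exact: ne.
  rewrite -ltnS -(ltn_pmul2r h0); apply: leq_ltn_trans lb _.
  by apply: ltn_trans ub.
have kE : (edge_line e).+1 = (blk (upper_index e) * h)%N.
  by apply/eqP; rewrite eqn_leq lb' andbT E; exact: ub'.
have bd sd : boundary (Omega_ h (edge_block sd e)) x.
  rewrite /boundary; have jb := blk_lb (edge_row e); have ju := blk_ub (edge_row e).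
  move/andP: xj => [xj1 xj2].
  have cx : (blk (edge_row e) * h)%N%:R < crd (~~ edge_dir e) x < ((blk (edge_row e)).+1 * h)%N%:R.
    apply/andP; split.
      by apply: le_lt_trans xj1; rewrite ler_nat.
    by apply: (lt_le_trans xj2); rewrite ler_nat.
  split.
    rewrite (Omega_E (edge_dir e)) cix_edge_block cixN_edge_block; apply: closure_ibox => //.
      by rewrite ltr_nat ltn_pmul2r.
    by rewrite xk kE; case: sd; rewrite !ler_nat !leq_pmul2r // ?E leqnn leqnSn.
  move=> /interior_subset; rewrite (Omega_E (edge_dir e)) cix_edge_block cixN_edge_block.
  move=> [/andP[]]; rewrite xk kE !ltr_nat => l1 l2 _.
  by case: sd l1 l2 => l1 l2; [rewrite ltnn in l1|rewrite E ltnn in l2].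
exists (edge_block false e), (edge_block true e); split => //.
by apply: (@adjacent_cix (edge_dir e)); rewrite ?cixN_edge_block // !cix_edge_block.
Qed.

Lemma open_Omega_ s : open (Omega_ h s : set (R * R)).
Proof. exact: open_box. Qed.

(** An edge inside a subdomain is in an open set that is disjoint from all other
    subdomains, hence it meets no boundary of a subdomain. *)
Lemma edge_interface_blocks e : I_Gamma R K h e -> edge_block false e != edge_block true e.
Proof.
move=> /(_ _ (edge_mid_edge e))[s [t [_ [cls nint] _]]]; apply/negP => /eqP E.
have uz := edge_interior E (edge_mid_edge e).
have nz : nbhs (edge_mid e) (Omega_ h (edge_block false e)).
  by apply: open_nbhs_nbhs; split => //; exact: open_Omega_.
have [y [sy uy]] := cls _ nz.
apply: nint; rewrite (Omega_disjoint sy uy).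
by have /interior_id -> := @open_Omega_ (edge_block false e).
Qed.

End Grid.

(** * The discrete spaces and their degrees of freedom *)

Section Fields.
Context {R : realType}.
Variables (K h : nat).
Hypothesis h0 : (0 < h)%N.
Notation n := (K * h)%N.
Implicit Types (i : bool) (T : 'I_n * 'I_n) (e : edge n n) (s t : 'I_K * 'I_K).
Implicit Types (p q : R * R -> R * R).
Notation enbhd e := (edge_nbhd (edge_dir e) (edge_line e).+1%:R (edge_row e)%:R).
Notation ehalf sd e := (half_nbhd sd (edge_dir e) (edge_line e).+1%:R (edge_row e)%:R).
Notation eflux e := (has_flux (edge_dir e) (edge_line e).+1%:R (edge_row e)%:R).
Notation Om := (Omega n n : set (R * R)).
Notation edge_block := (edge_block h0).

Let bOm : bounded_domain Om.
Proof. exact: bounded_domain_box. Qed.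

Lemma bounded_Omega_ s : bounded_domain (Omega_ h s : set (R * R)).
Proof. exact: bounded_domain_box. Qed.

Lemma YP p : @Y R n n p <-> (exists g, has_div0 Om p g) /\ forall T, RT0 (pixel T) p.
Proof. by split => -[/(Hdiv0P _ bOm) a b]; split. Qed.

Lemma YsP s p : Y_ n n h s p <->
  (exists g, has_div0 (Omega_ h s) p g) /\
  forall T, pixel T `<=` (Omega_ h s : set (R * R)) -> RT0 (pixel T) p.
Proof. by split => -[/(Hdiv0P _ (bounded_Omega_ s)) a b]; split. Qed.

(** Omega with a layer of cells around it, in which fields are extended by zero:
    the edges of the boundary of Omega become interior edges. *)
Definition margin : set (R * R) := box (- 1) (n%:R + 1) (- 1) (n%:R + 1).

Lemma Omega_margin : Om `<=` margin.
Proof. by move=> x [/andP[? ?] /andP[? ?]]; split; apply/andP; split; lra. Qed.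

Lemma half_nbhdP sd i (m : nat) (j : 'I_n) : (m <= n)%N ->
  (exists T, half_nbhd sd i m%:R j%:R = pixel T :> set (R * R)) \/
  (m = (if sd then n else 0%N) /\
   forall x : R * R, half_nbhd sd i m%:R j%:R x -> ~ Om x).
Proof.
move=> mn; case: sd.
  have [mlt|mge] := ltnP m n.
    left; exists (mkix i (Ordinal mlt) j).
    by rewrite (pixelE i) cix_mkix cixN_mkix /= -!natr1.
  right; have -> : m = n by apply/eqP; rewrite eqn_leq mn.
  split => // x; rewrite (OmegaE _ _ i) => -[/andP[? _] _] [/andP[_ ?] _]; lra.
case: m mn => [_|m mn].
  right; split => // x; rewrite (OmegaE _ _ i) => -[/andP[_ ?] _] [/andP[? _] _]; lra.
left; exists (mkix i (Ordinal mn) j).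
by rewrite (pixelE i) cix_mkix cixN_mkix /= -!natr1 addrK.
Qed.

(** On the edges of the boundary of Omega the field is zero on the outer side, so
    that its flux is zero. *)
Lemma grid_flux p i (m : nat) (j : 'I_n) : (m <= n)%N ->
  (exists g, has_div0 margin p g) -> (forall T, RT0 (pixel T) p) ->
  (forall x, ~ Om x -> p x = 0) ->
  exists2 v, has_flux i m%:R j%:R p v & (m = 0%N \/ m = n -> v = 0).
Proof.
move=> mn [g pg] rt p0.
have [v pv] : exists v, has_flux i m%:R j%:R p v.
  apply: (flux_exists (bounded_domain_box _ _ _ _) _ pg).
    have mR : m%:R <= n%:R :> R by rewrite ler_nat.
    have m0 : 0 <= m%:R :> R by [].
    have jR : j%:R + 1 <= n%:R :> R by rewrite natr1 ler_nat.
    have j0R : 0 <= j%:R :> R by [].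
    have me : margin = ibox i (- 1) (n%:R + 1) (- 1) (n%:R + 1) by rewrite iboxE; case: i.
    rewrite -/margin me => x [/andP[_]]; rewrite ltr_norml => /andP[? ?] /andP[? ?].
    by split; apply/andP; split; lra.
  move=> sd; have [[T ->]|[_ out]] := half_nbhdP sd i j mn; first exact: rt.
  by apply: eq_RT0 (RT00 _) => x Hx; rewrite p0 //; exact: out.
exists v => // mE.
have [sd out] : exists sd, forall x : R * R, half_nbhd sd i m%:R j%:R x -> ~ Om x.
  case: mE => mE; [exists false|exists true]; rewrite mE => x Hx; clear mE.
    by move: Hx; rewrite (OmegaE _ _ i) => -[/andP[_ ?] _] [/andP[? _] _]; lra.
  by move: Hx; rewrite (OmegaE _ _ i) => -[/andP[? _] _] [/andP[_ ?] _]; lra.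
by apply: (has_flux_zero (s := sd) _ pv) => x /out; exact: p0.
Qed.

Lemma Y_grid p : @Y R n n p ->
  [/\ exists g, has_div0 margin (zero_ext Om p) g, forall T, RT0 (pixel T) (zero_ext Om p)
   & forall x, ~ Om x -> zero_ext Om p x = 0].
Proof.
move=> /YP[[g pg] rt]; split.
- exists (g \_ Om); apply: has_div0_zero_ext pg; [exact: bounded_domain_box| |exact: Omega_margin].
  exact: measurable_box.
- move=> T; apply: eq_RT0 (rt T) => x /(pixel_Omega h0) Ox.
  by rewrite /zero_ext mem_set.
- by move=> x nO; rewrite /zero_ext memNset.
Qed.

Lemma Ys_grid s q : Y_ n n h s q ->
  [/\ exists g, has_div0 margin (zero_ext (Omega_ h s) q) g,
      forall T, RT0 (pixel T) (zero_ext (Omega_ h s) q)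
   & forall x, ~ Om x -> zero_ext (Omega_ h s) q x = 0].
Proof.
move=> /YsP[[g pg] rt]; split.
- exists (g \_ (Omega_ h s)).
  apply: has_div0_zero_ext pg; [exact: bounded_domain_box|exact: measurable_box|].
  by move=> x /(Omega_sub h0); exact: Omega_margin.
- move=> T; have [E|sT] := eqVneq s (block h0 T).
    have := @pixel_Omega_ R K h h0 T; rewrite -E => TO.
    by apply: eq_RT0 (rt T TO) => x /TO Ox; rewrite /zero_ext mem_set.
  apply: eq_RT0 (RT00 _) => x Tx; rewrite /zero_ext memNset //.
  exact: (pixel_disjoint sT).
- move=> x nO; rewrite /zero_ext memNset // => sx; apply: nO.
  exact: (Omega_sub h0 sx).
Qed.

(** The degree of freedom is a [lim], which is meaningful only if the limit
    exists; a flux provides it. *)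
Lemma dof_flux p e v : eflux e p v -> dof p e = v.
Proof.
move=> /has_flux_cvg.
by case: e => -[a b] /= cv; apply/cvg_lim => //; exact: Rhausdorff.
Qed.

Lemma Y_flux p e : @Y R n n p -> eflux e p (dof p e).
Proof.
move=> Yp; have [Zp rt out] := Y_grid Yp.
have kn : ((edge_line e).+1 <= n)%N by exact: ltnW (upper_index_subproof (edge_line e)).
have [v pv _] := grid_flux (edge_dir e) (edge_row e) kn Zp rt out.
have pv' : eflux e p v.
  apply: eq_has_flux pv => x /(enbhd_Omega h0) Ox.
  by rewrite /zero_ext mem_set.
by rewrite (dof_flux pv').
Qed.

Lemma YD p q : @Y R n n p -> @Y R n n q -> @Y R n n (vadd p q).
Proof.
move=> /YP[[g pg] rp] /YP[[k qk] rq]; apply/YP; split.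
  by exists (fun x => g x + k x); exact: has_div0D.
by move=> T; exact: RT0D.
Qed.

Lemma YZ c p : @Y R n n p -> @Y R n n (fun x => (c * (p x).1, c * (p x).2)).
Proof.
move=> /YP[[g pg] rp]; apply/YP; split.
  by exists (fun x => c * g x); exact: has_div0Z.
by move=> T; exact: RT0Z.
Qed.

Lemma Y_sum (I : Type) (r : seq I) (P : pred I) (F : I -> R * R -> R * R) :
  (forall k, P k -> @Y R n n (F k)) -> @Y R n n (fun x => \sum_(k <- r | P k) F k x).
Proof.
move=> FY; apply/YP; split.
  by apply: has_div0_sum => // k /FY /YP[].
by move=> T; apply: RT0_sum => k /FY /YP[].
Qed.

Lemma dofD p q e : @Y R n n p -> @Y R n n q -> dof (vadd p q) e = dof p e + dof q e.
Proof. by move=> Yp Yq; apply: dof_flux; apply: has_fluxD; exact: Y_flux. Qed.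

Lemma dofZ c p e : @Y R n n p ->
  dof (fun x => (c * (p x).1, c * (p x).2)) e = c * dof p e.
Proof. by move=> Yp; apply: dof_flux; apply: has_fluxZ; exact: Y_flux. Qed.

(** Makes the degrees of freedom of the interface part, which is only determined
    up to null sets, computable from those of the field. *)
Lemma dof_ae p q e : @Y R n n p -> @Y R n n q ->
  {ae leb2 R, forall x, Omega n n x -> p x = q x} -> dof p e = dof q e.
Proof.
move=> Yp Yq pq.
by apply: has_flux_ae_unique pq (Y_flux e Yp) (Y_flux e Yq); exact: enbhd_Omega.
Qed.

Lemma Y_zero_ext s q : Y_ n n h s q -> @Y R n n (zero_ext (Omega_ h s) q).
Proof.
move=> Yq; apply/YP; have [_ rt _] := Ys_grid Yq; split => //.
case/YsP : Yq => -[g qg] _; exists (g \_ (Omega_ h s)).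
by apply: has_div0_zero_ext qg => //; [exact: measurable_box|exact: Omega_sub].
Qed.

Lemma Y_I_Y p : Y_I n n K h p -> @Y R n n p.
Proof. by move=> [q Yq ->]; apply: Y_sum => s _; exact: Y_zero_ext. Qed.

(** If one of the two pixels is outside the subdomain, the extended field is zero
    on that side, and one side determines the flux. *)
Lemma dof_zero_ext s q e : Y_ n n h s q ->
  dof (zero_ext (Omega_ h s) q) e =
    if (edge_block false e == s) && (edge_block true e == s) then dof q e else 0.
Proof.
move=> Yq; have fl := Y_flux e (Y_zero_ext Yq); case: ifPn.
  move=> /andP[/eqP e1 /eqP e2]; apply/esym/dof_flux.
  apply: eq_has_flux fl => x /enbhd_pixel[sd].
  move/(pixel_Omega_ h0); rewrite -/(edge_block sd e) => Ox.
  by rewrite /zero_ext mem_set //; move: Ox; case: sd; rewrite ?e1 ?e2.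
rewrite negb_and => /orP side.
have [sd sE] : exists sd, s != edge_block sd e.
  by case: side => ne; [exists false|exists true]; rewrite eq_sym.
apply: (has_flux_zero (s := sd) _ fl) => x; rewrite ehalfE => Tx.
by rewrite /zero_ext memNset //; exact: (pixel_disjoint sE).
Qed.

Lemma dof_dsum (q : 'I_K * 'I_K -> R * R -> R * R) e :
  (forall s, Y_ n n h s (q s)) ->
  dof (fun x => \sum_s zero_ext (Omega_ h s) (q s) x) e =
    if edge_block false e == edge_block true e then dof (q (edge_block false e)) e else 0.
Proof.
move=> Yq.
rewrite (@dof_flux _ _ (\sum_s dof (zero_ext (Omega_ h s) (q s)) e)); last first.
  by apply: has_flux_sum => s _; apply: Y_flux; exact: Y_zero_ext.
under eq_bigr do rewrite dof_zero_ext //.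
case: ifPn => [/eqP <-|ne].
  rewrite (bigD1 (edge_block false e)) //= eqxx /= big1 ?addr0 // => s ns.
  by rewrite andbb eq_sym (negbTE ns).
rewrite big1 // => s _; case: ifPn => // /andP[/eqP e1 /eqP e2].
by rewrite e1 e2 eqxx in ne.
Qed.

(** By this the constraint on the interior part no longer refers to a choice of
    the summands q s. *)
Lemma C_IP p : C_I n n K h p <-> Y_I n n K h p /\
  forall e, edge_block false e = edge_block true e -> `|dof p e| <= 1.
Proof.
split=> [[q Cq pE]|[[q Yq pE] pC]].
  have Yq s : Y_ n n h s (q s) by case: (Cq s).
  split; first by exists q.
  move=> e E; rewrite pE dof_dsum // E eqxx; case: (Cq (edge_block true e)) => _; apply.
  by rewrite -E; exact: edge_interior.
exists q => // s; split => // e Ie.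
have E := edge_of_subdomain h0 Ie.
have := pC e; rewrite !E pE dof_dsum // !E eqxx; exact.
Qed.

Lemma dof_Y_I_interface p e : Y_I n n K h p -> I_Gamma R K h e -> dof p e = 0.
Proof.
move=> [q Yq ->] /(edge_interface_blocks h0) ne.
by rewrite dof_dsum // (negbTE ne).
Qed.

Variable psi : edge n n -> R * R -> R * R.
Hypothesis psiP : dual_basis psi.

Lemma Y_Gamma_Y p : Y_Gamma K h psi p -> @Y R n n p.
Proof.
by move=> [c ->]; apply: Y_sum => e _; apply: YZ; case: (psiP e).
Qed.

Lemma dof_interface (c : edge n n -> R) e :
  dof (fun x => \sum_(e' | e' \in I_Gamma R K h)
    (c e' * (psi e' x).1, c e' * (psi e' x).2)) e =
  if e \in I_Gamma R K h then c e else 0.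
Proof.
apply: dof_flux.
have -> : (if e \in I_Gamma R K h then c e else 0) =
    \sum_(e' | e' \in I_Gamma R K h) c e' * dof (psi e') e.
  have dE e' : dof (psi e') e = (e' == e)%:R by case: (psiP e').
  under eq_bigr do rewrite dE; case: ifPn => eG.
    rewrite (bigD1 e) //= eqxx mulr1 big1 ?addr0 // => e' /andP[_ ne].
    by rewrite (negbTE ne) mulr0.
  rewrite big1 // => e' e'G; have [E|_] := eqVneq e' e; last by rewrite mulr0.
  by rewrite -E e'G in eG.
by apply: has_flux_sum => e' _; apply: has_fluxZ; apply: Y_flux; case: (psiP e').
Qed.

Lemma dof_Y_Gamma_interior p e : Y_Gamma K h psi p -> ~ I_Gamma R K h e -> dof p e = 0.
Proof. by move=> [c ->] neG; rewrite dof_interface memNset. Qed.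

End Fields.

(** * Splitting a field into its interior and interface parts *)

Section Decomposition.
Context {R : realType}.
Variables (K h : nat).
Hypothesis h0 : (0 < h)%N.
Notation n := (K * h)%N.
Implicit Types (i : bool) (T : 'I_n * 'I_n) (e : edge n n) (s t : 'I_K * 'I_K).
Implicit Types (p q r : R * R -> R * R).
Notation eflux e := (has_flux (edge_dir e) (edge_line e).+1%:R (edge_row e)%:R).
Notation Om := (Omega n n : set (R * R)).
Notation edge_block := (edge_block h0).

Lemma edge_dir_mkedge i (k : 'I_n.-1) (j : 'I_n) : edge_dir (mkedge i k j) = i.
Proof. by case: i. Qed.
Lemma edge_line_mkedge i (k : 'I_n.-1) (j : 'I_n) : edge_line (mkedge i k j) = k.
Proof. by case: i. Qed.
Lemma edge_row_mkedge i (k : 'I_n.-1) (j : 'I_n) : edge_row (mkedge i k j) = j.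
Proof. by case: i. Qed.

Lemma grid_line_edge i (c : nat) (j : 'I_n) : (0 < c < K)%N ->
  exists2 e, I_Gamma R K h e & [/\ edge_dir e = i, (edge_line e).+1 = (c * h)%N & edge_row e = j].
Proof.
move=> /andP[c0 cK].
have ch0 : (0 < c * h)%N by rewrite muln_gt0 c0.
have kn : ((c * h).-1 < n.-1)%N.
  by rewrite -ltnS !prednK // ?ltn_pmul2r // muln_gt0 (ltn_trans c0 cK).
exists (mkedge i (Ordinal kn) j); last first.
  by rewrite edge_dir_mkedge edge_line_mkedge edge_row_mkedge /= prednK.
apply: (edge_interface (h0 := h0)); rewrite edge_block_eq; apply/negP => /eqP E.
have := blk_lb h0 (lower_index (mkedge i (Ordinal kn) j)); rewrite E.
rewrite /= edge_line_mkedge /= prednK // mulnK // => /(leq_trans _).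
move=> /(_ (c * h)%N (leqnn _)); rewrite leqNgt => /negP; apply.
by rewrite prednK.
Qed.

Variable r : R * R -> R * R.
Hypothesis Yr : @Y R n n r.
Hypothesis r0 : forall e, I_Gamma R K h e -> dof r e = 0.

(** The edges on a line bounding subdomains are on Gamma, where the flux vanishes
    by assumption, or on the boundary of Omega. *)
Lemma flux_grid_line i (c : nat) (j : 'I_n) : (c <= K)%N ->
  has_flux i (c * h)%N%:R j%:R (zero_ext Om r) 0.
Proof.
move=> cK; have [Zr rt out] := Y_grid h0 Yr.
have mn : (c * h <= n)%N by rewrite leq_pmul2r.
have [v rv v0] := grid_flux i j mn Zr rt out.
suff <- : v = 0 by [].
have [c0|c0] := posnP c; first by apply: v0; left; rewrite c0.
have [cK'|cK'] := ltnP c K; last first.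
  by apply: v0; right; congr muln; apply/eqP; rewrite eqn_leq cK.
have [|e eG [eE kE jE]] := @grid_line_edge i c j; first by rewrite c0.
have := Y_flux h0 e Yr; rewrite (r0 eG) => fl.
have flz : eflux e (zero_ext Om r) 0.
  apply: eq_has_flux fl => x /(enbhd_Omega h0) Ox.
  by rewrite /zero_ext mem_set.
rewrite -(dof_flux flz); apply/esym/dof_flux.
by rewrite eE kE jE.
Qed.

(** On the pixels adjacent to the line this is the vanishing of the flux.  On the
    others the distance to the line is at least 1 and the field is bounded.  The
    sum of the constants over the pixels serves them all. *)
Lemma vanish_linearly i (c : nat) : (c <= K)%N ->
  exists B, forall T x, pixel T x ->
    `|crd i (r x)| <= B * `|crd i x - (c * h)%N%:R|.
Proof.
move=> cK; set m := (c * h)%N.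
have loc T : exists B, 0 <= B /\ forall x, pixel T x ->
    `|crd i (r x)| <= B * `|crd i x - m%:R|.
  have [near_|far] := boolP ((m == cix i T) || (m == (cix i T).+1)).
    have [B BP] := flux_grid_line i (cix (~~ i) T) cK.
    exists `|B|; split => // x Tx.
    have Ox := pixel_Omega h0 Tx.
    have Px : edge_nbhd i m%:R (cix (~~ i) T)%:R x.
      move: Tx near_; rewrite (pixelE i) -natr1 => -[/andP[x1 x2] x3].
      case/orP => /eqP ->.
        apply: (half_nbhd_sub (s := true)); split; last by rewrite natr1.
        by rewrite x1 x2.
      apply: (half_nbhd_sub (s := false)); split; last by rewrite natr1.
      by rewrite -natr1 addrK x1 x2.
    have := BP x Px; rewrite /zero_ext mem_set // subr0 => /le_trans; apply.
    by rewrite ler_wpM2r // ler_norm.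
  have [_ rt] := (YP K h r).1 Yr.
  have [L [B LB]] := RT0_crd i m%:R (rt T).
  exists (`|L| + `|B|); split; first by rewrite addr_ge0.
  move=> x Tx; have := LB x Tx => E.
  have d1 : 1 <= `|crd i x - m%:R|.
    move: Tx far; rewrite (pixelE i) negb_or -natr1 => -[/andP[x1 x2] _] /andP[n1 n2].
    have [mT|mT] := ltnP m (cix i T).
      have : m.+1%:R <= (cix i T)%:R :> R by rewrite ler_nat.
      rewrite -natr1 => ?; rewrite ger0_norm; lra.
    have : (cix i T).+2%:R <= m%:R :> R.
      by rewrite ler_nat ltn_neqAle eq_sym n2 ltn_neqAle eq_sym n1.
    rewrite -natr1 -natr1 => ?; rewrite ler0_norm; lra.
  have -> : crd i (r x) = L + B * (crd i x - m%:R) by rewrite -E; ring.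
  apply: le_trans (ler_normD _ _) _; rewrite normrM mulrDl lerD2r.
  by rewrite ler_peMr.
have [B BP] := choice loc.
exists (\sum_T B T) => T x Tx; have [_ /(_ x Tx) /le_trans] := BP T; apply.
rewrite ler_wpM2r // (bigD1 T) //= lerDl sumr_ge0 // => T' _.
by case: (BP T').
Qed.

(** The subdomain is cut out of Omega by four half planes.  The bound of
    [vanish_linearly] holds on the entire line, so the cuts can be made one after
    the other. *)
Lemma Y_restrict s : Y_ n n h s r.
Proof.
have [[g rg] rt] := (YP K h r).1 Yr; apply/YsP; split; last by move=> T _; exact: rt.
exists g.
have cut D i sg c : bounded_domain D -> D `<=` Om -> `|sg| = 1 :> R -> (c <= K)%N ->
    has_div0 D r g -> let D' := D `&` [set x | 0 < sg * (crd i x - (c * h)%N%:R)] in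
    [/\ bounded_domain D', D' `<=` Om & has_div0 D' r g].
  move=> bD DO sg1 cK Dg; split.
  - by apply: bounded_domainI => //; exact: measurable_halfplane.
  - by move=> x [/DO].
  have [B BP] := vanish_linearly i cK.
  apply: (@has_div0_cut R D r g i sg (c * h)%N%:R B bD sg1 Dg).
  apply: ae2S (@ae_pixel R K h) => x xT Dx _.
  by have [T Tx] := xT (DO x Dx); exact: BP Tx.
have n1 : `|1| = 1 :> R by rewrite normr1.
have n2 : `|-1| = 1 :> R by rewrite normrN normr1.
have bO : bounded_domain Om by exact: bounded_domain_box.
have [b1 o1 z1] := cut _ true 1 s.1 bO (@subset_refl _ _) n1 (ltnW (ltn_ord _)) rg.
have [b2 o2 z2] := cut _ true (-1) s.1.+1 b1 o1 n2 (ltn_ord _) z1.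
have [b3 o3 z3] := cut _ false 1 s.2 b2 o2 n1 (ltnW (ltn_ord _)) z2.
have [_ _ z4] := cut _ false (-1) s.2.+1 b3 o3 n2 (ltn_ord _) z3.
set D := (X in has_div0 X _ _) in z4; suff <- : D = Omega_ h s by [].
apply/seteqP; split => x; rewrite /D /=.
  by move=> [[[[_ ?] ?] ?] ?]; split; apply/andP; split; lra.
move=> Ox; have := Omega_sub h0 Ox; move: Ox => [/andP[? ?] /andP[? ?]] ?.
by split; [split; [split; [split|]|]|] => //; lra.
Qed.

End Decomposition.

Section Splitting.
Context {R : realType}.
Variables (K h : nat).
Hypothesis h0 : (0 < h)%N.
Notation n := (K * h)%N.
Implicit Types (e : edge n n) (s : 'I_K * 'I_K) (p q : R * R -> R * R).
Variable psi : edge n n -> R * R -> R * R.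
Hypothesis psiP : dual_basis psi.

Lemma interface_part_exists p : @Y R n n p -> exists pG, is_interface_part K h psi p pG.
Proof.
move=> Yp.
pose pG x := \sum_(e | e \in I_Gamma R K h)
  (dof p e * (psi e x).1, dof p e * (psi e x).2).
have GpG : Y_Gamma K h psi pG by exists (dof p).
have YpG : @Y R n n pG by apply: (Y_Gamma_Y psiP).
(* The same r, restricted to each subdomain, provides all the interior parts. *)
pose r := vadd p (fun x => (-1 * (pG x).1, -1 * (pG x).2)).
have Yr : @Y R n n r by apply: YD => //; exact: YZ.
have r0 e : I_Gamma R K h e -> dof r e = 0.
  move=> eG; rewrite dofD //; last exact: YZ.
  by rewrite dofZ // (dof_interface h0 psiP) mem_set // mulN1r subrr.
exists pG; split => //.
exists (fun x => \sum_(s : 'I_K * 'I_K) zero_ext (Omega_ h s) r x).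
  by exists (fun=> r) => // s; exact: Y_restrict.
apply: ae2S (@ae_pixel R K h) => x xT /xT[T Tx].
rewrite /vadd (bigD1 (block h0 T)) //= big1 ?addr0; last first.
  by move=> s sT; rewrite /zero_ext memNset //; exact: pixel_disjoint sT Tx.
rewrite /zero_ext mem_set; last exact: pixel_Omega_ Tx.
rewrite /r /vadd !mulN1r [p x]surjective_pairing [pG x]surjective_pairing.
by congr pair; rewrite /= subrK.
Qed.

Lemma Y_vadd pI pG : Y_I n n K h pI -> Y_Gamma K h psi pG -> @Y R n n (vadd pI pG).
Proof.
by move=> /(Y_I_Y h0) YI /(Y_Gamma_Y psiP) YG; exact: YD.
Qed.

Lemma C_vadd pI pG : Y_I n n K h pI -> Y_Gamma K h psi pG ->
  C n n (vadd pI pG) <-> C_I n n K h pI /\ C_Gamma K h psi pG.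
Proof.
move=> YI YG; have YI' := Y_I_Y h0 YI; have YG' := Y_Gamma_Y psiP YG.
have dI e : I_Gamma R K h e -> dof (vadd pI pG) e = dof pG e.
  by move=> eG; rewrite dofD // (dof_Y_I_interface h0 YI eG) add0r.
have dG e : ~ I_Gamma R K h e -> dof (vadd pI pG) e = dof pI e.
  by move=> eG; rewrite dofD // (dof_Y_Gamma_interior h0 psiP YG eG) addr0.
split=> [[_ pC]|[/(C_IP K h0)[_ cI] [_ cG]]].
  split; last by split => // e eG; rewrite -dI.
  apply/(C_IP K h0); split => // e E; rewrite -dG //.
  by move=> /(edge_interface_blocks h0); rewrite E eqxx.
split; first exact: Y_vadd.
move=> e; have [eG|eG] := pselect (I_Gamma R K h e); first by rewrite dI //; exact: cG.
rewrite dG //; apply: cI; apply/eqP/negPn/negP => ne; apply: eG.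
exact: edge_interface ne.
Qed.

Lemma C_Gamma_nonempty : exists z, Y_Gamma K h psi z /\ C_Gamma K h psi z.
Proof.
pose z x := \sum_(e | e \in I_Gamma R K h) (0 * (psi e x).1, 0 * (psi e x).2).
have Yz : Y_Gamma K h psi z by exists (fun=> 0).
exists z; split => //; split => // e _.
by rewrite (dof_interface h0 psiP (fun=> 0)) if_same normr0 ler01.
Qed.

End Splitting.

(** * The functional *)

Section Functional.
Context {R : realType}.
Variables (n : nat) (alpha : R) (f : R * R -> R).
Hypotheses (alpha0 : 0 < alpha) (fL2 : L2 (Omega n n) f).
Implicit Types (p q : R * R -> R * R).
Notation Om := (Omega n n : set (R * R)).

Lemma J_ge0 p : (0 <= J n n alpha f p)%E.
Proof.
apply: mule_ge0; first by rewrite lee_fin invr_ge0 mulr_ge0 // ltW.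
by apply: integral_ge0 => x _; rewrite lee_fin sqr_ge0.
Qed.

(** Both fields have the same weak divergences, and [weak_div] picks one by the
    predicate only; so the equality holds everywhere. *)
Lemma weak_div_ae p q : L2field Om p -> L2field Om q ->
  {ae leb2 R, forall x, Om x -> p x = q x} -> weak_div Om p = weak_div Om q.
Proof.
move=> pL qL pq; rewrite /weak_div; congr xget; apply/funext => g.
rewrite /is_weak_div; congr and; apply: eq_forall => phi.
apply: eq_forall => cphi; congr eq.
have c1 : C1 phi by case: cphi.
apply: (@ae_eq_Rintegral _ _ _ (leb2 R)).
- exact: measurable_box.
- by apply: L1_measurable; apply: L1_flux pL c1; exact: bounded_domain_box.
- by apply: L1_measurable; apply: L1_flux qL c1; exact: bounded_domain_box.
- by apply: ae2S pq => x pqx Ox; rewrite pqx.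
Qed.

Lemma J_le_ae p q : L2field Om p -> L2field Om q ->
  {ae leb2 R, forall x, Om x -> p x = q x} ->
  (J n n alpha f q <= J n n alpha f p)%E.
Proof. by move=> pL qL pq; rewrite /J (weak_div_ae pL qL pq). Qed.

Lemma J_lty p : Hdiv Om p -> (J n n alpha f p < +oo)%E.
Proof.
move=> [_ [g pg]]; have [wL2 _] : is_weak_div Om p (weak_div Om p).
  by apply: xgetPex; exists g.
have mO : measurable Om by exact: measurable_box.
have [_ iS] := L2D mO wL2 (L2Z alpha mO fL2).
apply: lte_mul_pinfty; rewrite ?lee_fin ?invr_ge0 ?mulr_ge0 ?(ltW alpha0) //.
exact: (@integrable_lty _ _ _ (leb2 R)).
Qed.

End Functional.

(** * The two minimization problems *)

Section ConstrainedMinimizers.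
Context {R : realType} {T : Type}.
Implicit Types (A S : set T) (F : T -> \bar R) (x y : T).

Lemma chi_in S x : S x -> chi R S x = 0%E.
Proof. by move=> Sx; rewrite /chi mem_set. Qed.

Lemma chi_out S x : ~ S x -> chi R S x = +oo%E.
Proof. by move=> Sx; rewrite /chi memNset. Qed.

Lemma le_adde_chi S F x y : S x -> S y ->
  (F x + chi R S x <= F y + chi R S y)%E = (F x <= F y)%E.
Proof. by move=> Sx Sy; rewrite !chi_in // !adde0. Qed.

(** Without a feasible point of finite cost any element of A would be a solution;
    with one, a solution is feasible. *)
Lemma is_solution_chiP A S F x : (forall y, (0 <= F y)%E) ->
  (exists z, [/\ A z, S z & (F z < +oo)%E]) ->
  is_solution A (fun y => F y + chi R S y)%E x <->
  [/\ A x, S x & forall y, A y -> S y -> (F x <= F y)%E].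
Proof.
move=> F0 [z [Az Sz Fz]].
have FNy y : (F y != -oo)%E by rewrite gt_eqF // (lt_le_trans _ (F0 y)).
split=> [[Ax xmin]|[Ax Sx xmin]].
  have Sx : S x.
    apply: contrapT => nSx; have := xmin z Az.
    by rewrite (chi_out nSx) (chi_in Sz) adde0 addey // leNgt Fz.
  by split=> // y Ay Sy; rewrite -(le_adde_chi F Sx Sy); exact: xmin.
split=> // y Ay; have [Sy|nSy] := pselect (S y); last first.
  by rewrite (chi_out nSy) addey // leey.
by rewrite (le_adde_chi F Sx Sy); exact: xmin.
Qed.

End ConstrainedMinimizers.

Unset Implicit Arguments.

Theorem proposition3p1 (R : realType) (M N K h : nat)
    (alpha : R) (f : R * R -> R)
    (psi : edge M N -> R * R -> R * R)
    (H : (R * R -> R * R) -> (R * R -> R * R)) :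
  (0 < K)%N -> (0 < h)%N -> M = (K * h)%N -> N = (K * h)%N ->
  0 < alpha -> L2 (Omega M N) f ->
  dual_basis psi ->
  is_local_minimizer K h psi alpha f H ->
  let P := is_solution (@Y R M N)
    (fun p => J M N alpha f p + chi R (@C R M N) p)%E in
  let P_Gamma := is_solution (Y_Gamma K h psi)
    (fun pG => J_Gamma M N alpha f H pG + chi R (C_Gamma K h psi) pG)%E in
  (forall p, P p -> P_Gamma (interface_part K h psi p)) /\
  (forall pG, P_Gamma pG -> P (vadd (H pG) pG)).
Proof.
move=> K0 h0 EM EN; subst M N => alpha0 fL2 psiP Hmin P P_Gamma.
pose JO := J (K * h) (K * h) alpha f.
pose JG := J_Gamma (K * h) (K * h) alpha f H.
have HC pG : Y_Gamma K h psi pG -> C_I (K * h) (K * h) K h (H pG).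
  by move=> /Hmin[].
have HY pG : Y_Gamma K h psi pG -> Y_I (K * h) (K * h) K h (H pG).
  by move=> /HC /(C_IP K h0)[].
have YV pI pG := @Y_vadd R K h h0 psi psiP pI pG.
have CV pI pG := @C_vadd R K h h0 psi psiP pI pG.
have YHV pG : Y_Gamma K h psi pG -> Y (K * h) (K * h) (vadd (H pG) pG).
  by move=> YG; apply: YV => //; exact: HY.
have CHV pG : Y_Gamma K h psi pG -> C_Gamma K h psi pG ->
    C (K * h) (K * h) (vadd (H pG) pG).
  by move=> YG CG; apply/(CV _ _ (HY _ YG) YG); split => //; exact: HC.
have best pI pG : C_I (K * h) (K * h) K h pI -> Y_Gamma K h psi pG ->
    (JG pG <= JO (vadd pI pG))%E.
  move=> CI YG; have [YI _] := (C_IP K h0 pI).1 CI.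
  have [CHG [_ /(_ pI YI) mn]] := Hmin pG YG.
  by rewrite (le_adde_chi (fun q => JO (vadd q pG)) CHG CI) in mn.
have decompose p pG : Y (K * h) (K * h) p -> is_interface_part K h psi p pG ->
    exists2 pI, (JO (vadd pI pG) <= JO p)%E & Y_I (K * h) (K * h) K h pI /\
      (C (K * h) (K * h) p -> C_I (K * h) (K * h) K h pI /\ C_Gamma K h psi pG).
  move=> Yp [YG [pI YI aep]]; have YpIG := YV _ _ YI YG; exists pI.
    by case: Yp YpIG => -[[pL _] _] _ [[[vL _] _] _]; exact: J_le_ae.
  split => // -[_ Cp]; apply/(CV _ _ YI YG); split => // e.
  by rewrite -(dof_ae h0 e Yp YpIG aep).
(* A feasible point of finite cost for both problems. *)
have [z [Yz Cz]] : exists z, Y_Gamma K h psi z /\ C_Gamma K h psi z.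
  exact: C_Gamma_nonempty.
have Jz : (JO (vadd (H z) z) < +oo)%E.
  by apply: J_lty => //; case: (YHV _ Yz) => -[].
have PE p : P p <-> [/\ Y (K * h) (K * h) p, C (K * h) (K * h) p &
    forall q, Y (K * h) (K * h) q -> C (K * h) (K * h) q -> (JO p <= JO q)%E].
  apply: (is_solution_chiP (F := JO)) => [q|]; first exact: J_ge0.
  by exists (vadd (H z) z); split; [exact: YHV|exact: CHV|].
have PGE pG : P_Gamma pG <-> [/\ Y_Gamma K h psi pG, C_Gamma K h psi pG &
    forall qG, Y_Gamma K h psi qG -> C_Gamma K h psi qG -> (JG pG <= JG qG)%E].
  apply: (is_solution_chiP (F := JG)) => [q|]; first exact: J_ge0.
  by exists z.
split=> [p /PE[Yp Cp pmin]|pG /PGE[YG CG pGmin]].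
  have pG_ : is_interface_part K h psi p (interface_part K h psi p).
    by apply: xgetPex; exact: interface_part_exists.
  have [pI le1 [YI /(_ Cp)[CI CG]]] := decompose _ _ Yp pG_.
  apply/PGE; split; [by case: pG_|exact: CG|] => qG YqG CqG.
  have le2 := best _ _ CI (pG_.1).
  have le3 := pmin _ (YHV _ YqG) (CHV _ YqG CqG).
  exact: le_trans (le_trans le2 le1) le3.
apply/PE; split; [exact: YHV|exact: CHV|] => q Yq Cq.
have [qG qG_] := interface_part_exists h0 psiP Yq.
have [qI le1 [YI /(_ Cq)[CI CqG]]] := decompose _ _ Yq qG_.
have YqG : Y_Gamma K h psi qG by case: qG_.
exact: le_trans (le_trans (pGmin qG YqG CqG) (best _ _ CI YqG)) le1.
Qed.
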